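(* $\mathsf{BIM}+\forall k[\mathbf{IRT}(k)]\vdash\mathbf{PH}$, where $\mathbf{PH}$ (Paris–Harrington) is the statement $\forall r\forall k\forall n\exists M[M\rightarrow_\ast(n)^k_r]$.
   Context: $\mathsf{BIM}$ is the two-sorted intuitionistic theory of natural numbers and functions $\mathbb N\to\mathbb N$ with extensionality, primitive recursive constants, closure of functions under composition, primitive recursion and unbounded search, and full induction. Finite sequences are coded by naturals ($length(c)$, entries $c(i)$). $D_\alpha=\{n\mid\alpha(n)\ne0\}$. $[\omega]^\omega$: strictly increasing $\zeta:\mathbb N\to\mathbb N$; $[\omega]^k$: codes of strictly increasing sequences of length $k$; for $s\in[\omega]^k$ and $\zeta$ (or a code $t$), $\zeta\circ s$ (resp. $t\circ s$) is the code of $\langle\zeta(s(0)),\dots,\zeta(s(k-1))\rangle$. $X$ is $k$-almost-full if $\forall\zeta\in[\omega]^\omega\exists s\in[\omega]^k[\zeta\circ s\in X]$. For $k\ge1$, $\mathbf{IRT}(k)$ is: for all $\alpha,\beta$, if $D_\alpha$ and $D_\beta$ are $k$-almost-full then $D_\alpha\cap D_\beta$ is $k$-almost-full. For positive $m,k$, $[m]^k=\{s\in[\omega]^k\mid s(k-1)<m\}$. $c:[m]^k\to r$ means every $s\in[m]^k$ satisfies $s<length(c)$ and every $i<length(c)$ satisfies $c(i)<r$. $M\rightarrow_\ast(n)^k_r$ means: for every $c:[M]^k\to r$ there exist $l$ and $s\in[M]^l$ with $l\ge n$, $l\ge s(0)$ and $c(s\circ u)=c(s\circ v)$ for all $u,v\in[l]^k$.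 *)

(* Defs.v *)
From Stdlib Require Import List.

(** * Syntax of BIM *)

(** Names for the primitive recursive functions.  All of them are unary; an
    n-ary primitive recursive function is named through the pairing function,
    e.g. [f(m, n)] is [f (J m n)].  [CRec f g] is the function h with
    h(m, 0) = f(m) and h(m, n + 1) = g((m, n), h(m, n)). *)
Inductive const : Type :=
| CId | CZero | CSucc | CK | CL
| CComp (f g : const)
| CPair (f g : const)
| CRec (f g : const).

(** Numerical variables and function variables have separate de Bruijn
    indices: a numerical quantifier binds the numerical variable 0 and leaves
    the function variables alone, and vice versa. *)
Inductive fn : Type :=
| FVar (i : nat)
| FConst (c : const).

Inductive tm : Type :=
| Var (i : nat)
| Zero
| App (F : fn) (t : tm)
| J (t u : tm).

Inductive form : Type :=
| Bot
| Eq0 (t u : tm)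
| Eq1 (F G : fn)
| And (A B : form)
| Or (A B : form)
| Imp (A B : form)
| All0 (A : form)
| Ex0 (A : form)
| All1 (A : form)
| Ex1 (A : form).

Declare Scope form_scope.
Delimit Scope form_scope with form.
Bind Scope form_scope with form.
Open Scope form_scope.

Notation "# i" := (Var i) (at level 9, i at level 9, format "# i") : form_scope.
Notation "$ i" := (FVar i) (at level 9, i at level 9, format "$ i") : form_scope.
Notation "F @ t" := (App F t) (at level 40, left associativity) : form_scope.
Notation "t ≐ u" := (Eq0 t u) (at level 70) : form_scope.
Notation "A ⊓ B" := (And A B) (at level 80, right associativity) : form_scope.
Notation "A ⊔ B" := (Or A B) (at level 85, right associativity) : form_scope.
Notation "A ⇒ B" := (Imp A B) (at level 90, right associativity) : form_scope.
Notation "∀₀ A" := (All0 A) (at level 95, right associativity) : form_scope.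
Notation "∃₀ A" := (Ex0 A) (at level 95, right associativity) : form_scope.
Notation "∀₁ A" := (All1 A) (at level 95, right associativity) : form_scope.
Notation "∃₁ A" := (Ex1 A) (at level 95, right associativity) : form_scope.

Definition Not (A : form) : form := A ⇒ Bot.
Definition Iff (A B : form) : form := (A ⇒ B) ⊓ (B ⇒ A).
Definition Succ (t : tm) : tm := FConst CSucc @ t.

(** ** Simultaneous substitution *)

Definition scons {X : Type} (x : X) (s : nat -> X) (i : nat) : X :=
  match i with O => x | S j => s j end.

Definition fsubst (tau : nat -> fn) (F : fn) : fn :=
  match F with FVar i => tau i | FConst c => FConst c end.

Fixpoint tsubst (sigma : nat -> tm) (tau : nat -> fn) (t : tm) : tm :=
  match t with
  | Var i => sigma i
  | Zero => Zero
  | App F t => App (fsubst tau F) (tsubst sigma tau t)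
  | J t u => J (tsubst sigma tau t) (tsubst sigma tau u)
  end.

Definition tlift0 : tm -> tm := tsubst (fun i => #(S i)) FVar.
Definition tlift1 : tm -> tm := tsubst Var (fun i => $(S i)).
Definition flift1 : fn -> fn := fsubst (fun i => $(S i)).

Definition up0 (sigma : nat -> tm) : nat -> tm :=
  scons #0 (fun i => tlift0 (sigma i)).
Definition up1 (tau : nat -> fn) : nat -> fn :=
  scons $0 (fun i => flift1 (tau i)).

Fixpoint subst (sigma : nat -> tm) (tau : nat -> fn) (A : form) : form :=
  match A with
  | Bot => Bot
  | Eq0 t u => Eq0 (tsubst sigma tau t) (tsubst sigma tau u)
  | Eq1 F G => Eq1 (fsubst tau F) (fsubst tau G)
  | And A B => And (subst sigma tau A) (subst sigma tau B)
  | Or A B => Or (subst sigma tau A) (subst sigma tau B)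
  | Imp A B => Imp (subst sigma tau A) (subst sigma tau B)
  | All0 A => All0 (subst (up0 sigma) tau A)
  | Ex0 A => Ex0 (subst (up0 sigma) tau A)
  | All1 A => All1 (subst (fun i => tlift1 (sigma i)) (up1 tau) A)
  | Ex1 A => Ex1 (subst (fun i => tlift1 (sigma i)) (up1 tau) A)
  end.

Definition lift0 : form -> form := subst (fun i => #(S i)) FVar.
Definition lift1 : form -> form := subst Var (fun i => $(S i)).
Definition inst0 (t : tm) : form -> form := subst (scons t Var) FVar.
Definition inst1 (F : fn) : form -> form := subst Var (scons F FVar).

(** * Intuitionistic natural deduction

    [prv T Gamma A]: A is derivable from the axioms T and the assumptions
    Gamma.  Only Gamma is lifted by the eigenvariable rules, so T has to be
    closed under substitution, as [BIM] and sentences are. *)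

Inductive prv (T : form -> Prop) : list form -> form -> Prop :=
| prv_axiom Γ A : T A -> prv T Γ A
| prv_hyp Γ A : In A Γ -> prv T Γ A
| prv_botE Γ A : prv T Γ Bot -> prv T Γ A
| prv_andI Γ A B : prv T Γ A -> prv T Γ B -> prv T Γ (A ⊓ B)
| prv_andE1 Γ A B : prv T Γ (A ⊓ B) -> prv T Γ A
| prv_andE2 Γ A B : prv T Γ (A ⊓ B) -> prv T Γ B
| prv_orI1 Γ A B : prv T Γ A -> prv T Γ (A ⊔ B)
| prv_orI2 Γ A B : prv T Γ B -> prv T Γ (A ⊔ B)
| prv_orE Γ A B C :
    prv T Γ (A ⊔ B) -> prv T (A :: Γ) C -> prv T (B :: Γ) C -> prv T Γ C
| prv_impI Γ A B : prv T (A :: Γ) B -> prv T Γ (A ⇒ B)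
| prv_impE Γ A B : prv T Γ (A ⇒ B) -> prv T Γ A -> prv T Γ B
| prv_all0I Γ A : prv T (map lift0 Γ) A -> prv T Γ (∀₀ A)
| prv_all0E Γ A t : prv T Γ (∀₀ A) -> prv T Γ (inst0 t A)
| prv_ex0I Γ A t : prv T Γ (inst0 t A) -> prv T Γ (∃₀ A)
| prv_ex0E Γ A C :
    prv T Γ (∃₀ A) -> prv T (A :: map lift0 Γ) (lift0 C) -> prv T Γ C
| prv_all1I Γ A : prv T (map lift1 Γ) A -> prv T Γ (∀₁ A)
| prv_all1E Γ A F : prv T Γ (∀₁ A) -> prv T Γ (inst1 F A)
| prv_ex1I Γ A F : prv T Γ (inst1 F A) -> prv T Γ (∃₁ A)
| prv_ex1E Γ A C :
    prv T Γ (∃₁ A) -> prv T (A :: map lift1 Γ) (lift1 C) -> prv T Γ C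
| prv_eq0_refl Γ t : prv T Γ (t ≐ t)
| prv_eq0_subst Γ A t u :
    prv T Γ (t ≐ u) -> prv T Γ (inst0 t A) -> prv T Γ (inst0 u A)
| prv_eq1_refl Γ F : prv T Γ (Eq1 F F)
| prv_eq1_subst Γ A F G :
    prv T Γ (Eq1 F G) -> prv T Γ (inst1 F A) -> prv T Γ (inst1 G A).

Definition provable (T : form -> Prop) (A : form) : Prop := prv T nil A.

(** The theory T + A, for a sentence A. *)
Definition extend (T : form -> Prop) (A : form) : form -> Prop :=
  fun B => T B \/ B = A.

(** * Order, and the axioms of BIM *)

Definition CPlus : const := CRec CId (CComp CSucc CL).
(** n - 1, with 0 - 1 = 0. *)
Definition CPred : const := CRec CZero (CComp CL CK).

Definition tplus (t u : tm) : tm := FConst CPlus @ J t u.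
Definition tpred (t : tm) : tm := FConst CPred @ J Zero t.

Definition fle (t u : tm) : form := ∃₀ tplus (tlift0 t) #0 ≐ tlift0 u.
Definition flt (t u : tm) : form := fle (Succ t) u.
Notation "t ≼ u" := (fle t u) (at level 70) : form_scope.
Notation "t ≺ u" := (flt t u) (at level 70) : form_scope.

(** J is pinned down by the recursion equations of Cantor's enumeration of
    pairs (0,0), (0,1), (1,0), (0,2), ..., so that J, K and L are primitive
    recursive. *)
Inductive BIM : form -> Prop :=
| bim_ext : BIM (∀₁ ∀₁ Iff (Eq1 $1 $0) (∀₀ $1 @ #0 ≐ $0 @ #0))
| bim_id : BIM (∀₀ FConst CId @ #0 ≐ #0)
| bim_zero : BIM (∀₀ FConst CZero @ #0 ≐ Zero)
| bim_succ_neq0 : BIM (∀₀ Not (Succ #0 ≐ Zero))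
| bim_succ_inj : BIM (∀₀ ∀₀ Succ #1 ≐ Succ #0 ⇒ #1 ≐ #0)
| bim_J00 : BIM (J Zero Zero ≐ Zero)
| bim_J0S : BIM (∀₀ J Zero (Succ #0) ≐ Succ (J #0 Zero))
| bim_JS : BIM (∀₀ ∀₀ J (Succ #1) #0 ≐ Succ (J #1 (Succ #0)))
| bim_K : BIM (∀₀ ∀₀ FConst CK @ J #1 #0 ≐ #1)
| bim_L : BIM (∀₀ ∀₀ FConst CL @ J #1 #0 ≐ #0)
| bim_comp f g :
    BIM (∀₀ FConst (CComp f g) @ #0 ≐ FConst f @ (FConst g @ #0))
| bim_pair f g :
    BIM (∀₀ FConst (CPair f g) @ #0 ≐ J (FConst f @ #0) (FConst g @ #0))
| bim_rec0 f g :
    BIM (∀₀ FConst (CRec f g) @ J #0 Zero ≐ FConst f @ #0)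
| bim_recS f g :
    BIM (∀₀ ∀₀ FConst (CRec f g) @ J #1 (Succ #0)
               ≐ FConst g @ J (J #1 #0) (FConst (CRec f g) @ J #1 #0))
(* closure of the functions under composition (with unary functions and with
   J), primitive recursion and unbounded search *)
| bim_cl_comp : BIM (∀₁ ∀₁ ∃₁ ∀₀ $0 @ #0 ≐ $2 @ ($1 @ #0))
| bim_cl_pair : BIM (∀₁ ∀₁ ∃₁ ∀₀ $0 @ #0 ≐ J ($2 @ #0) ($1 @ #0))
| bim_cl_rec :
    BIM (∀₁ ∀₁ ∃₁ ∀₀ ($0 @ J #0 Zero ≐ $2 @ #0) ⊓
           (∀₀ $0 @ J #1 (Succ #0) ≐ $1 @ J (J #1 #0) ($0 @ J #1 #0)))
| bim_cl_search :
    BIM (∀₁ (∀₀ ∃₀ $0 @ J #1 #0 ≐ Zero) ⇒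
            ∃₁ ∀₀ ($1 @ J #0 ($0 @ #0) ≐ Zero) ⊓
                  (∀₀ #0 ≺ $0 @ #1 ⇒ Not ($1 @ J #1 #0 ≐ Zero)))
| bim_ind A :
    BIM (inst0 Zero A ⊓
         (∀₀ A ⇒ subst (scons (Succ #0) (fun i => #(S i))) FVar A) ⇒ ∀₀ A).

(** * Finite sequences

    The code of <a_0, ..., a_{k-1}> is
    J k (J a_0 (J a_1 (... (J a_{k-1} 0)))). *)

(** (c, i) |-> L(L(...L(c))), with i occurrences of L. *)
Definition CIterL : const := CRec CId (CComp CL CL).
Definition CEntry : const := CComp CK (CComp CL CIterL).

Definition tlength (c : tm) : tm := FConst CK @ c.
Definition tentry (c i : tm) : tm := FConst CEntry @ J c i.

(** Every c has a length and entries; requiring 0 in the tail makes the code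
    of a finite sequence unique. *)
Definition is_seq (c : tm) : form :=
  FConst CIterL @ J c (Succ (tlength c)) ≐ Zero.

(** zeta ∈ [ω]^ω *)
Definition incr_fun (zeta : fn) : form :=
  ∀₀ ∀₀ #1 ≺ #0 ⇒ zeta @ #1 ≺ zeta @ #0.

(** s ∈ [ω]^k *)
Definition incr_seq (s k : tm) : form :=
  is_seq s ⊓ tlength s ≐ k ⊓
  (∀₀ ∀₀ #1 ≺ #0 ⇒ #0 ≺ tlift0 (tlift0 k) ⇒
     tentry (tlift0 (tlift0 s)) #1 ≺ tentry (tlift0 (tlift0 s)) #0).

(** s ∈ [m]^k *)
Definition incr_seq_below (s m k : tm) : form :=
  incr_seq s k ⊓ tentry s (tpred k) ≺ m.

(** x = zeta ∘ s, for a function zeta *)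
Definition fun_comp (x : tm) (zeta : fn) (s : tm) : form :=
  is_seq x ⊓ tlength x ≐ tlength s ⊓
  (∀₀ #0 ≺ tlength (tlift0 s) ⇒
     tentry (tlift0 x) #0 ≐ zeta @ tentry (tlift0 s) #0).

(** x = t ∘ s, for a code t *)
Definition seq_comp (x t s : tm) : form :=
  is_seq x ⊓ tlength x ≐ tlength s ⊓
  (∀₀ #0 ≺ tlength (tlift0 s) ⇒
     tentry (tlift0 x) #0 ≐ tentry (tlift0 t) (tentry (tlift0 s) #0)).

(** * The intuitionistic Ramsey theorem *)

(** A set of numbers is given by a formula X in which the numerical variable 0
    stands for the element.  In [almost_full] the variables bound are
    zeta = $0, s = #1 and x = #0 = zeta ∘ s, and X is renamed so that its
    element is x. *)
Definition almost_full (k : tm) (X : form) : form :=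
  ∀₁ incr_fun $0 ⇒
    ∃₀ incr_seq #0 (tlift0 (tlift1 k)) ⊓
      (∃₀ fun_comp #0 $0 #1 ⊓
        subst (scons #0 (fun i => #(S (S i)))) (fun i => $(S i)) X).

(** D_F *)
Definition D (F : fn) : form := Not (F @ #0 ≐ Zero).

Definition IRT (k : tm) : form :=
  ∀₁ ∀₁ almost_full (tlift1 (tlift1 k)) (D $1) ⊓
        almost_full (tlift1 (tlift1 k)) (D $0) ⇒
        almost_full (tlift1 (tlift1 k)) (D $1 ⊓ D $0).

(** ∀k ≥ 1 [IRT(k)] *)
Definition all_IRT : form := ∀₀ Succ Zero ≼ #0 ⇒ IRT #0.

(** * The Paris-Harrington statement *)

(** c : [m]^k -> r *)
Definition colouring (c m k r : tm) : form :=
  is_seq c ⊓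
  (∀₀ incr_seq_below #0 (tlift0 m) (tlift0 k) ⇒ #0 ≺ tlength (tlift0 c)) ⊓
  (∀₀ #0 ≺ tlength (tlift0 c) ⇒ tentry (tlift0 c) #0 ≺ tlift0 r).

(** c(s ∘ u) = c(s ∘ v) for all u, v ∈ [l]^k; the variables bound are, in this
    order, u = #3, v = #2, x = #1 = s ∘ u and y = #0 = s ∘ v. *)
Definition homogeneous (c s l k : tm) : form :=
  let up2 t := tlift0 (tlift0 t) in
  ∀₀ ∀₀ incr_seq_below #1 (up2 l) (up2 k) ⇒
        incr_seq_below #0 (up2 l) (up2 k) ⇒
        ∃₀ ∃₀ seq_comp #1 (up2 (up2 s)) #3 ⊓ seq_comp #0 (up2 (up2 s)) #2 ⊓
              tentry (up2 (up2 c)) #1 ≐ tentry (up2 (up2 c)) #0.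

(** M ->_* (n)^k_r; the variables bound are c, l and s, in this order. *)
Definition ph_arrow (M n k r : tm) : form :=
  let up3 t := tlift0 (tlift0 (tlift0 t)) in
  ∀₀ colouring #0 (tlift0 M) (tlift0 k) (tlift0 r) ⇒
    ∃₀ ∃₀ Zero ≺ #1 ⊓ incr_seq_below #0 (up3 M) #1 ⊓
          up3 n ≼ #1 ⊓ tentry #0 Zero ≼ #1 ⊓
          homogeneous #2 #0 #1 (up3 k).

(** ∀r ∀k ∀n ∃M [M ->_* (n)^k_r], with M positive *)
Definition PH : form :=
  ∀₀ ∀₀ ∀₀ ∃₀ Zero ≺ #0 ⊓ ph_arrow #0 #1 #2 #3.

(* Main.v *)
(** The combinatorial core needs no compactness.  Fix r, k and n, call m good if every colouring of the increasing k-tuples below m with r + 1 colours has a relatively large homogeneous set of length at least n, and otherwise let c_m be the least bad colouring.  Colour an increasing (k+1)-tuple x with last entry m by the colour that c_m gives to the other entries.  For every i, the tuples whose last entry is good or whose colour is not i are almost full: along an increasing ζ, the set ζ(0), ..., ζ(l-1) is relatively large for large l, so it is not homogeneous for the bad colouring of ζ(l).  Induction on i with IRT(k + 1) shows that the tuples with good last entry or with colour at least i are almost full, and for i = r + 1 a good m results.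

Derivations are found semantically.  A set of formulas that does not derive C extends (classically, in the metatheory) to a prime set with witnesses that does not derive C, and its terms form a structure.  Provability of the prime set implies truth in this structure for all formulas used as assumptions, and truth implies provability for existential and decided formulas.  So a sequent between such formulas is derivable once it holds in all such structures, which are classical models of the quantifier-free part of BIM with induction for quantifier-free formulas; only the steps outside this fragment are derived by hand. *)

From Stdlib Require Import List Arith Lia.
From Stdlib Require Import Classical ClassicalEpsilon FunctionalExtensionality.
From Stdlib Require Import PropExtensionality ProofIrrelevance.
From Stdlib Require Cantor.
Require Import Defs.
Import ListNotations.

(** * Substitution *)

(** Each tuple carries its own m as last entry, so the unrelated colourings c_m combine into a
    single colouring of (k+1)-tuples. IRT applies only to sets [D F] of functions, so the colour has
    to be computable: a bad colouring can be cut or padded to a fixed length without ceasing to be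
    bad, which bounds the search for the least one. The extra colour makes room for a default value:
    an entry beyond the length of a code reads 0, and 0 must be a colour even if r = 0. What blocks
    a purely semantic derivation is that in a saturated set a true universal formula, or a true
    implication with an undecided antecedent, may fail to be provable. Two devices deal with this. A
    predicate with bounded quantifiers is named by one constant, the same for all models, and the
    resulting equation passes between truth and provability. Almost fullness, with its function
    quantifier, stays in the calculus: the models see only its matrix for one fixed ζ, and the
    induction on i is an instance of the full induction of BIM, as r is a variable of the theory. *)

Lemma fsubst_comp τ2 τ1 F :
  fsubst τ2 (fsubst τ1 F) = fsubst (fun i => fsubst τ2 (τ1 i)) F.
Proof. destruct F; reflexivity. Qed.

Lemma fsubst_id F : fsubst FVar F = F.
Proof. destruct F; reflexivity. Qed.

Lemma tsubst_comp σ2 τ2 σ1 τ1 t :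
  tsubst σ2 τ2 (tsubst σ1 τ1 t) =
  tsubst (fun i => tsubst σ2 τ2 (σ1 i)) (fun i => fsubst τ2 (τ1 i)) t.
Proof.
  induction t; simpl; rewrite ?fsubst_comp; congruence.
Qed.

Lemma tsubst_id t : tsubst Var FVar t = t.
Proof. induction t; simpl; rewrite ?fsubst_id; congruence. Qed.

Lemma up0_comp σ2 τ2 σ1 :
  (fun i => tsubst (up0 σ2) τ2 (up0 σ1 i)) = up0 (fun i => tsubst σ2 τ2 (σ1 i)).
Proof.
  extensionality i; destruct i; [reflexivity|].
  cbn [up0 scons]; unfold tlift0; rewrite !tsubst_comp; f_equal.
  extensionality j; cbn; now rewrite fsubst_id.
Qed.

Lemma up1_comp τ2 τ1 :
  (fun i => fsubst (up1 τ2) (up1 τ1 i)) = up1 (fun i => fsubst τ2 (τ1 i)).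
Proof.
  extensionality i; destruct i; [reflexivity|].
  cbn [up1 scons]; unfold flift1; now rewrite !fsubst_comp.
Qed.

Lemma tlift1_comp σ2 τ2 (σ1 : nat -> tm) :
  (fun i => tsubst (fun j => tlift1 (σ2 j)) (up1 τ2) (tlift1 (σ1 i))) =
  (fun i => tlift1 (tsubst σ2 τ2 (σ1 i))).
Proof. extensionality i; unfold tlift1; now rewrite !tsubst_comp. Qed.

Lemma subst_comp A : forall σ2 τ2 σ1 τ1,
  subst σ2 τ2 (subst σ1 τ1 A) =
  subst (fun i => tsubst σ2 τ2 (σ1 i)) (fun i => fsubst τ2 (τ1 i)) A.
Proof.
  induction A; intros; cbn [subst]; rewrite ?tsubst_comp, ?fsubst_comp,
    ?IHA, ?IHA1, ?IHA2, ?up0_comp, ?up1_comp, ?tlift1_comp; reflexivity.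
Qed.

Lemma up0_id : up0 Var = Var.
Proof. extensionality i; now destruct i. Qed.

Lemma up1_id : up1 FVar = FVar.
Proof. extensionality i; now destruct i. Qed.

Lemma subst_id A : subst Var FVar A = A.
Proof.
  induction A; cbn [subst]; rewrite ?tsubst_id, ?fsubst_id, ?up0_id, ?up1_id; try congruence.
  all: change (fun i => tlift1 #i) with Var; congruence.
Qed.

Ltac subst_norm :=
  unfold inst0, inst1, lift0, lift1, tlift0, tlift1, flift1;
  rewrite ?subst_comp, ?tsubst_comp, ?fsubst_comp.

Lemma subst_lift0 σ τ A : subst (up0 σ) τ (lift0 A) = lift0 (subst σ τ A).
Proof.
  subst_norm; f_equal; extensionality i; now rewrite fsubst_id.
Qed.

Lemma subst_lift1 σ τ A :
  subst (fun i => tlift1 (σ i)) (up1 τ) (lift1 A) = lift1 (subst σ τ A).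
Proof. subst_norm; f_equal. Qed.

Lemma subst_scons0 σ τ t A :
  inst0 t (subst (up0 σ) τ A) = subst (scons t σ) τ A.
Proof.
  subst_norm; f_equal.
  - extensionality i; destruct i; [reflexivity|]; cbn.
    unfold tlift0; rewrite tsubst_comp; apply tsubst_id.
  - extensionality i; apply fsubst_id.
Qed.

Lemma subst_inst0 σ τ t A :
  subst σ τ (inst0 t A) = inst0 (tsubst σ τ t) (subst (up0 σ) τ A).
Proof.
  rewrite subst_scons0; unfold inst0; rewrite subst_comp; f_equal.
  extensionality i; now destruct i.
Qed.

Lemma subst_scons1 σ τ F A :
  inst1 F (subst (fun i => tlift1 (σ i)) (up1 τ) A) = subst σ (scons F τ) A.
Proof.
  subst_norm; f_equal.
  - extensionality i; unfold tlift1; rewrite tsubst_comp; apply tsubst_id.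
  - extensionality i; destruct i; [reflexivity|]; cbn.
    unfold flift1; rewrite fsubst_comp; apply fsubst_id.
Qed.

Lemma subst_inst1 σ τ F A :
  subst σ τ (inst1 F A) =
  inst1 (fsubst τ F) (subst (fun i => tlift1 (σ i)) (up1 τ) A).
Proof.
  rewrite subst_scons1; unfold inst1; rewrite subst_comp; f_equal.
  extensionality i; now destruct i.
Qed.

Lemma subst_succ0 σ τ A :
  subst (up0 σ) τ (subst (scons (Succ #0) (fun i => #(S i))) FVar A) =
  subst (scons (Succ #0) (fun i => #(S i))) FVar (subst (up0 σ) τ A).
Proof.
  rewrite !subst_comp; f_equal; extensionality i.
  - destruct i; [reflexivity|]; cbn. unfold tlift0; rewrite tsubst_comp; reflexivity.
  - now rewrite fsubst_id.
Qed.

(** * The deduction relation *)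

Definition subst_closed (T : form -> Prop) : Prop :=
  forall A σ τ, T A -> T (subst σ τ A).

Lemma BIM_subst_closed : subst_closed BIM.
Proof.
  intros A σ τ H; destruct H; try (cbn; constructor).
  cbn [subst]. rewrite subst_inst0, subst_succ0. apply bim_ind.
Qed.

Definition theory : form -> Prop := extend BIM all_IRT.

Lemma theory_subst_closed : subst_closed theory.
Proof.
  intros A σ τ [H| ->]; [left; now apply BIM_subst_closed|right; reflexivity].
Qed.

Notation "Γ ⊢ A" := (prv theory Γ A) (at level 100, A at level 95).

Lemma weakening T Γ A : prv T Γ A -> forall Γ', incl Γ Γ' -> prv T Γ' A.
Proof.
  intros H; induction H; intros Γ' HΓ.
  - now apply prv_axiom.
  - apply prv_hyp; auto.
  - apply prv_botE; auto.
  - apply prv_andI; auto.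
  - eapply prv_andE1; auto.
  - eapply prv_andE2; auto.
  - apply prv_orI1; auto.
  - apply prv_orI2; auto.
  - eapply prv_orE; [now apply IHprv1|apply IHprv2|apply IHprv3];
      apply incl_cons; auto using in_eq, incl_tl.
  - apply prv_impI; apply IHprv; apply incl_cons; auto using in_eq, incl_tl.
  - eapply prv_impE; auto.
  - apply prv_all0I; apply IHprv; now apply incl_map.
  - apply prv_all0E; auto.
  - eapply prv_ex0I; auto.
  - eapply prv_ex0E; [now apply IHprv1|apply IHprv2].
    apply incl_cons; auto using in_eq, incl_tl, incl_map.
  - apply prv_all1I; apply IHprv; now apply incl_map.
  - apply prv_all1E; auto.
  - eapply prv_ex1I; auto.
  - eapply prv_ex1E; [now apply IHprv1|apply IHprv2].
    apply incl_cons; auto using in_eq, incl_tl, incl_map.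
  - apply prv_eq0_refl.
  - eapply prv_eq0_subst; auto.
  - apply prv_eq1_refl.
  - eapply prv_eq1_subst; auto.
Qed.

Lemma prv_subst T Γ A : subst_closed T -> prv T Γ A ->
  forall σ τ, prv T (map (subst σ τ) Γ) (subst σ τ A).
Proof.
  intros HT H; induction H; intros σ τ; cbn [subst] in *.
  - apply prv_axiom; auto.
  - apply prv_hyp; now apply in_map.
  - apply prv_botE; auto.
  - apply prv_andI; auto.
  - eapply prv_andE1; auto.
  - eapply prv_andE2; auto.
  - apply prv_orI1; auto.
  - apply prv_orI2; auto.
  - eapply prv_orE; [apply IHprv1|apply IHprv2|apply IHprv3].
  - apply prv_impI; apply IHprv.
  - eapply prv_impE; [apply IHprv1|apply IHprv2].
  - apply prv_all0I. specialize (IHprv (up0 σ) τ).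
    rewrite map_map in IHprv |- *; erewrite map_ext in IHprv; [exact IHprv|].
    intros; apply subst_lift0.
  - rewrite subst_inst0; apply prv_all0E; apply IHprv.
  - eapply prv_ex0I; rewrite <- subst_inst0; apply IHprv.
  - eapply prv_ex0E; [apply IHprv1|]. specialize (IHprv2 (up0 σ) τ).
    rewrite subst_lift0 in IHprv2. cbn [map] in IHprv2.
    rewrite map_map in IHprv2 |- *; erewrite map_ext in IHprv2; [exact IHprv2|].
    intros; apply subst_lift0.
  - apply prv_all1I. specialize (IHprv (fun i => tlift1 (σ i)) (up1 τ)).
    rewrite map_map in IHprv |- *; erewrite map_ext in IHprv; [exact IHprv|].
    intros; apply subst_lift1.
  - rewrite subst_inst1; apply prv_all1E; apply IHprv.
  - eapply prv_ex1I; rewrite <- subst_inst1; apply IHprv.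
  - eapply prv_ex1E; [apply IHprv1|]. specialize (IHprv2 (fun i => tlift1 (σ i)) (up1 τ)).
    rewrite subst_lift1 in IHprv2. cbn [map] in IHprv2.
    rewrite map_map in IHprv2 |- *; erewrite map_ext in IHprv2; [exact IHprv2|].
    intros; apply subst_lift1.
  - apply prv_eq0_refl.
  - rewrite subst_inst0; eapply prv_eq0_subst; [apply IHprv1|].
    rewrite <- subst_inst0; auto.
  - apply prv_eq1_refl.
  - rewrite subst_inst1; eapply prv_eq1_subst; [apply IHprv1|].
    rewrite <- subst_inst1; auto.
Qed.

(** * Prime extensions with witnesses *)

Definition code2 (k a b : nat) : nat := Cantor.to_nat (k, Cantor.to_nat (a, b)).

Lemma code2_inj k a b k' a' b' :
  code2 k a b = code2 k' a' b' -> k = k' /\ a = a' /\ b = b'.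
Proof.
  unfold code2; intros H; apply Cantor.to_nat_inj, pair_equal_spec in H as [-> H].
  now apply Cantor.to_nat_inj, pair_equal_spec in H as [-> ->].
Qed.

Fixpoint code_const (c : const) : nat :=
  match c with
  | CId => code2 0 0 0 | CZero => code2 1 0 0 | CSucc => code2 2 0 0
  | CK => code2 3 0 0 | CL => code2 4 0 0
  | CComp f g => code2 5 (code_const f) (code_const g)
  | CPair f g => code2 6 (code_const f) (code_const g)
  | CRec f g => code2 7 (code_const f) (code_const g)
  end.

Definition code_fn (F : fn) : nat :=
  match F with FVar i => code2 0 i 0 | FConst c => code2 1 (code_const c) 0 end.

Fixpoint code_tm (t : tm) : nat :=
  match t with
  | Var i => code2 0 i 0
  | Zero => code2 1 0 0
  | App F t => code2 2 (code_fn F) (code_tm t)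
  | J t u => code2 3 (code_tm t) (code_tm u)
  end.

Fixpoint code_form (A : form) : nat :=
  match A with
  | Bot => code2 0 0 0
  | Eq0 t u => code2 1 (code_tm t) (code_tm u)
  | Eq1 F G => code2 2 (code_fn F) (code_fn G)
  | And A B => code2 3 (code_form A) (code_form B)
  | Or A B => code2 4 (code_form A) (code_form B)
  | Imp A B => code2 5 (code_form A) (code_form B)
  | All0 A => code2 6 (code_form A) 0
  | Ex0 A => code2 7 (code_form A) 0
  | All1 A => code2 8 (code_form A) 0
  | Ex1 A => code2 9 (code_form A) 0
  end.

Lemma code_const_inj c : forall d, code_const c = code_const d -> c = d.
Proof.
  induction c; intros d H; destruct d; apply code2_inj in H as (? & ? & ?);
    try discriminate; f_equal; auto.
Qed.

Lemma code_fn_inj F G : code_fn F = code_fn G -> F = G.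
Proof.
  destruct F, G; intros H; apply code2_inj in H as (? & ? & ?);
    try discriminate; f_equal; auto using code_const_inj.
Qed.

Lemma code_tm_inj t : forall u, code_tm t = code_tm u -> t = u.
Proof.
  induction t; intros u H; destruct u; apply code2_inj in H as (? & ? & ?);
    try discriminate; f_equal; auto using code_fn_inj.
Qed.

Lemma code_form_inj A : forall B, code_form A = code_form B -> A = B.
Proof.
  induction A; intros B H; destruct B; apply code2_inj in H as (? & ? & ?);
    try discriminate; f_equal; auto using code_fn_inj, code_tm_inj.
Qed.

Lemma form_enumeration : exists e : nat -> form, forall A, exists n, e n = A.
Proof.
  exists (fun n => epsilon (inhabits Bot) (fun A => code_form A = n)).
  intros A; exists (code_form A); apply code_form_inj.
  apply (epsilon_spec (inhabits Bot) (fun B => code_form B = code_form A)).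
  now exists A.
Qed.

(** Freeness is expressed through substitution: n bounds the variables of both sorts as far as
    substitution can see them, which is all that the renaming of a fresh variable requires. *)
Definition vars_below (n : nat) (A : form) : Prop := forall σ σ' τ τ',
  (forall i, i < n -> σ i = σ' i) -> (forall i, i < n -> τ i = τ' i) ->
  subst σ τ A = subst σ' τ' A.

Lemma fvars_bound F : exists n, forall τ τ',
  (forall i, i < n -> τ i = τ' i) -> fsubst τ F = fsubst τ' F.
Proof. destruct F as [i|c]; [exists (S i)|exists 0]; cbn; auto. Qed.

Lemma tvars_bound t : exists n, forall σ σ' τ τ',
  (forall i, i < n -> σ i = σ' i) -> (forall i, i < n -> τ i = τ' i) ->
  tsubst σ τ t = tsubst σ' τ' t.
Proof.
  induction t as [i| |F t [n Hn]|t [n Hn] u [m Hm]].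
  - exists (S i); cbn; auto.
  - exists 0; cbn; auto.
  - destruct (fvars_bound F) as [m Hm]; exists (max n m); intros; cbn; f_equal;
      [apply Hm|apply Hn]; intros; auto with arith;
      match goal with H : _ |- _ => apply H; lia end.
  - exists (max n m); intros; cbn; f_equal; [apply Hn|apply Hm]; intros;
      match goal with H : _ |- _ => apply H; lia end.
Qed.

Lemma vars_below_exists A : exists n, vars_below n A.
Proof.
  unfold vars_below.
  induction A as [|t u|F G|A [n Hn] B [m Hm]|A [n Hn] B [m Hm]|A [n Hn] B [m Hm]
    |A [n Hn]|A [n Hn]|A [n Hn]|A [n Hn]].
  - exists 0; auto.
  - destruct (tvars_bound t) as [n Hn], (tvars_bound u) as [m Hm].
    exists (max n m); intros; cbn; f_equal; [apply Hn|apply Hm]; intros;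
      match goal with H : _ |- _ => apply H; lia end.
  - destruct (fvars_bound F) as [n Hn], (fvars_bound G) as [m Hm].
    exists (max n m); intros; cbn; f_equal; [apply Hn|apply Hm]; intros;
      match goal with H : _ |- _ => apply H; lia end.
  - exists (max n m); intros; cbn; f_equal; [apply Hn|apply Hm]; intros;
      match goal with H : _ |- _ => apply H; lia end.
  - exists (max n m); intros; cbn; f_equal; [apply Hn|apply Hm]; intros;
      match goal with H : _ |- _ => apply H; lia end.
  - exists (max n m); intros; cbn; f_equal; [apply Hn|apply Hm]; intros;
      match goal with H : _ |- _ => apply H; lia end.
  - exists n; intros ? ? ? ? Hσ Hτ; cbn; f_equal; apply Hn; auto.
    intros [|i] Hi; cbn; auto. rewrite Hσ; auto with arith.
  - exists n; intros ? ? ? ? Hσ Hτ; cbn; f_equal; apply Hn; auto.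
    intros [|i] Hi; cbn; auto. rewrite Hσ; auto with arith.
  - exists n; intros ? ? ? ? Hσ Hτ; cbn; f_equal; apply Hn.
    + intros; now rewrite Hσ.
    + intros [|i] Hi; cbn; auto. rewrite Hτ; auto with arith.
  - exists n; intros ? ? ? ? Hσ Hτ; cbn; f_equal; apply Hn.
    + intros; now rewrite Hσ.
    + intros [|i] Hi; cbn; auto. rewrite Hτ; auto with arith.
Qed.

Lemma vars_below_list Γ : exists n, forall A, In A Γ -> vars_below n A.
Proof.
  induction Γ as [|A Γ [n Hn]]; [exists 0; intros ? []|].
  destruct (vars_below_exists A) as [m Hm]; exists (max n m).
  intros B [<-|HB] σ σ' τ τ' Hσ Hτ; [apply Hm|apply (Hn B HB)]; intros;
    match goal with H : _ |- _ => apply H; lia end.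
Qed.

(* A fresh variable serves as the eigenvariable: renaming it to 0 and raising the others turns instances into bodies and the context into its lift. *)
Lemma fresh_witness0 Γ A C : (Γ ⊢ ∃₀ A) ->
  exists t, (inst0 t A :: Γ ⊢ C) -> Γ ⊢ C.
Proof.
  intros HA. destruct (vars_below_list (A :: C :: Γ)) as [n Hn].
  exists (Var n); intros H.
  pose (σ := fun i => if i =? n then #0 else #(S i)).
  assert (Hσ : forall i, i < n -> σ i = #(S i)).
  { intros i Hi; unfold σ; now rewrite (proj2 (Nat.eqb_neq i n)) by lia. }
  assert (HL : forall B, In B (C :: Γ) -> subst σ FVar B = lift0 B).
  { intros B HB; apply (Hn B); auto using in_cons. }
  apply (prv_subst _ _ _ theory_subst_closed) with (σ := σ) (τ := FVar) in H.
  eapply prv_ex0E; [exact HA|].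
  rewrite HL in H by apply in_eq. cbn [map] in H.
  replace (subst σ FVar (inst0 #n A)) with A in H.
  - erewrite map_ext_in in H; [exact H|]. intros; apply HL; now apply in_cons.
  - unfold inst0; rewrite subst_comp. rewrite <- (subst_id A) at 1.
    apply (Hn A (in_eq _ _)); auto.
    intros [|i] Hi; cbn; [unfold σ; now rewrite Nat.eqb_refl|].
    symmetry; apply Hσ; lia.
Qed.

Lemma fresh_witness1 Γ A C : (Γ ⊢ ∃₁ A) ->
  exists F, (inst1 F A :: Γ ⊢ C) -> Γ ⊢ C.
Proof.
  intros HA. destruct (vars_below_list (A :: C :: Γ)) as [n Hn].
  exists (FVar n); intros H.
  pose (τ := fun i => if i =? n then $0 else $(S i)).
  assert (Hτ : forall i, i < n -> τ i = $(S i)).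
  { intros i Hi; unfold τ; now rewrite (proj2 (Nat.eqb_neq i n)) by lia. }
  assert (HL : forall B, In B (C :: Γ) -> subst Var τ B = lift1 B).
  { intros B HB; apply (Hn B); auto using in_cons. }
  apply (prv_subst _ _ _ theory_subst_closed) with (σ := Var) (τ := τ) in H.
  eapply prv_ex1E; [exact HA|].
  rewrite HL in H by apply in_eq. cbn [map] in H.
  replace (subst Var τ (inst1 $n A)) with A in H.
  - erewrite map_ext_in in H; [exact H|]. intros; apply HL; now apply in_cons.
  - unfold inst1; rewrite subst_comp. rewrite <- (subst_id A) at 1.
    apply (Hn A (in_eq _ _)); auto.
    intros [|i] Hi; cbn; [unfold τ; now rewrite Nat.eqb_refl|].
    symmetry; apply Hτ; lia.
Qed.

(** The clauses are those of a prime intuitionistic theory. Such a set may leave an implication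
    undecided, and it may contain all instances of a universal formula without the formula
    itself. *)
Record saturated (Δ : form -> Prop) : Prop := {
  sat_prv : forall Γ A, (forall B, In B Γ -> Δ B) -> (Γ ⊢ A) -> Δ A;
  sat_bot : ~ Δ Bot;
  sat_or : forall A B, Δ (A ⊔ B) -> Δ A \/ Δ B;
  sat_ex0 : forall A, Δ (∃₀ A) -> exists t, Δ (inst0 t A);
  sat_ex1 : forall A, Δ (∃₁ A) -> exists F, Δ (inst1 F A)
}.

Lemma cut Γ A C : (Γ ⊢ A) -> (A :: Γ ⊢ C) -> Γ ⊢ C.
Proof. intros HA HC; eapply prv_impE; [apply prv_impI; exact HC|exact HA]. Qed.

(** A is rejected only if it would make C derivable. Otherwise it is accepted, and an existential A
    brings along an instance at a variable fresh for the context and for C, which keeps C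
    underivable. *)
Lemma henkin_step C Γ A : ~ (Γ ⊢ C) -> exists Γ',
  incl Γ Γ' /\ ~ (Γ' ⊢ C) /\
  ((A :: Γ ⊢ C) \/
   In A Γ' /\ (forall B, A = (∃₀ B) -> exists t, In (inst0 t B) Γ') /\
              (forall B, A = (∃₁ B) -> exists F, In (inst1 F B) Γ')).
Proof.
  intros HC. destruct (classic (A :: Γ ⊢ C)) as [HA|HA].
  - exists Γ; auto using incl_refl.
  - destruct (classic (exists B, A = (∃₀ B))) as [[B ->]|H0];
      [|destruct (classic (exists B, A = (∃₁ B))) as [[B ->]|H1]].
    + destruct (fresh_witness0 ((∃₀ B) :: Γ) B C) as [t Ht];
        [apply prv_hyp, in_eq|].
      exists (inst0 t B :: (∃₀ B) :: Γ); repeat split; auto using incl_tl, incl_refl.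
      right; repeat split; [cbn; auto| |discriminate].
      intros B' [= <-]; exists t; apply in_eq.
    + destruct (fresh_witness1 ((∃₁ B) :: Γ) B C) as [F HF];
        [apply prv_hyp, in_eq|].
      exists (inst1 F B :: (∃₁ B) :: Γ); repeat split; auto using incl_tl, incl_refl.
      right; repeat split; [cbn; auto|discriminate|].
      intros B' [= <-]; exists F; apply in_eq.
    + exists (A :: Γ); repeat split; auto using incl_tl, incl_refl.
      right; repeat split; [apply in_eq| |]; intros B HB; exfalso; eauto.
Qed.

Lemma saturated_extension Γ C : ~ (Γ ⊢ C) ->
  exists Δ, saturated Δ /\ (forall A, In A Γ -> Δ A) /\ ~ Δ C.
Proof.
  intros HC. destruct form_enumeration as [e He].
  assert (step : forall (X : {Γ | ~ (Γ ⊢ C)}) A, {Y : {Γ | ~ (Γ ⊢ C)} |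
    let Γ := proj1_sig X in let Γ' := proj1_sig Y in incl Γ Γ' /\
    ((A :: Γ ⊢ C) \/
     In A Γ' /\ (forall B, A = (∃₀ B) -> exists t, In (inst0 t B) Γ') /\
                (forall B, A = (∃₁ B) -> exists F, In (inst1 F B) Γ'))}).
  { intros [Γ0 H0] A; apply constructive_indefinite_description.
    destruct (henkin_step C Γ0 A H0) as (Γ' & H1 & H2 & H3).
    now exists (exist _ Γ' H2). }
  pose (stage := fix stage n := match n with
    | O => exist _ Γ HC
    | S m => proj1_sig (step (stage m) (e m)) end).
  pose (G n := proj1_sig (stage n)).
  assert (Gmono : forall n m, n <= m -> incl (G n) (G m)).
  { intros n m H; induction H; [apply incl_refl|].
    eapply incl_tran; [exact IHle|].
    apply (proj2_sig (step (stage m) (e m))). }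
  pose (Δ A := exists n, In A (G n)).
  assert (Gfin : forall Γ', (forall B, In B Γ' -> Δ B) -> exists n, incl Γ' (G n)).
  { induction Γ' as [|A Γ' IH]; intros H; [exists 0; intros ? []|].
    destruct IH as [n Hn]; [intros; apply H; now right|].
    destruct (H A (in_eq _ _)) as [m Hm].
    exists (max n m); apply incl_cons.
    - apply (Gmono m); auto with arith.
    - eapply incl_tran; [exact Hn|]; apply Gmono; auto with arith. }
  assert (GC : forall n, ~ (G n ⊢ C)) by (intros n; exact (proj2_sig (stage n))).
  (* A derivable formula cannot be rejected at its turn: by cut, C would become derivable at a
     finite stage. *)
  assert (Δprv : forall Γ' A, (forall B, In B Γ' -> Δ B) -> (Γ' ⊢ A) -> Δ A).
  { intros Γ' A HΓ HA. destruct (Gfin _ HΓ) as [n Hn], (He A) as [m <-].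
    destruct (proj2_sig (step (stage m) (e m))) as [_ [H|H]].
    - exfalso; apply (GC (max n m)). apply (cut _ (e m)).
      + eapply weakening; [exact HA|]. eapply incl_tran; [exact Hn|]; apply Gmono; lia.
      + eapply weakening; [exact H|]. apply incl_cons; [apply in_eq|].
        apply incl_tl; apply Gmono; lia.
    - exists (S m); apply H. }
  assert (ΔC : ~ Δ C) by (intros [n Hn]; apply (GC n); now apply prv_hyp).
  (* A formula may enter as the instance of another one, outside its own turn. Even so it cannot be
     rejected at its turn, and there it receives its own witness. *)
  assert (Δin : forall A, Δ A -> exists n,
     In A (G n) /\ (forall B, A = (∃₀ B) -> exists t, In (inst0 t B) (G n)) /\
                   (forall B, A = (∃₁ B) -> exists F, In (inst1 F B) (G n))).
  { intros A [n Hn]; destruct (He A) as [m <-].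
    destruct (proj2_sig (step (stage m) (e m))) as [_ [H|H]]; [|now exists (S m)].
    exfalso; apply (GC (max n m)). apply (cut _ (e m)).
    - apply prv_hyp; apply (Gmono n); [lia|exact Hn].
    - eapply weakening; [exact H|]. apply incl_cons; [apply in_eq|].
      apply incl_tl; apply Gmono; lia. }
  exists Δ; split; [split|split].
  - exact Δprv.
  - intros H; apply ΔC; apply (Δprv [Bot]).
    + intros B [<-|[]]; exact H.
    + apply prv_botE, prv_hyp, in_eq.
  - intros A B HAB. 
    (* A formula outside Δ was rejected. If this happens to both disjuncts, each yields C, and then
       so does the disjunction. *)
    assert (HX : forall X, ~ Δ X -> exists n, (X :: G n ⊢ C)).
    { intros X HX; destruct (He X) as [m <-]; exists m.
      destruct (proj2_sig (step (stage m) (e m))) as [_ [H|H]]; [exact H|].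
      exfalso; apply HX; exists (S m); apply H. }
    apply NNPP; intros Hno; apply not_or_and in Hno as [HA HB].
    apply HX in HA as [n Hn]; apply HX in HB as [m Hm].
    destruct HAB as [k Hk]; apply (GC (max k (max n m))).
    apply prv_orE with A B.
    + apply prv_hyp; apply (Gmono k); [lia|exact Hk].
    + eapply weakening; [exact Hn|]. apply incl_cons; [apply in_eq|].
      apply incl_tl; apply Gmono; lia.
    + eapply weakening; [exact Hm|]. apply incl_cons; [apply in_eq|].
      apply incl_tl; apply Gmono; lia.
  - intros A HA; destruct (Δin _ HA) as (n & _ & H & _).
    destruct (H A eq_refl) as [t Ht]; exists t; now exists n.
  - intros A HA; destruct (Δin _ HA) as (n & _ & _ & H).
    destruct (H A eq_refl) as [F HF]; exists F; now exists n.
  - intros A HA; now exists 0.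
  - exact ΔC.
Qed.

(** * Derived rules *)

Ltac hyp := apply prv_hyp; repeat (first [left; reflexivity | right]).

Ltac compute_subst :=
  cbn [inst0 inst1 lift0 lift1 subst tsubst fsubst up0 up1 scons tlift0 tlift1 flift1
       map tplus tpred tlength tentry Not Iff Succ fle flt].

Lemma prv_instE0 Γ A t B : (Γ ⊢ ∀₀ A) -> inst0 t A = B -> Γ ⊢ B.
Proof. intros H <-; now apply prv_all0E. Qed.

Lemma prv_instE1 Γ A F B : (Γ ⊢ ∀₁ A) -> inst1 F A = B -> Γ ⊢ B.
Proof. intros H <-; now apply prv_all1E. Qed.

Lemma prv_instE00 Γ A t u B :
  (Γ ⊢ ∀₀ ∀₀ A) -> subst (scons u (scons t Var)) FVar A = B -> Γ ⊢ B.
Proof.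
  intros H <-. rewrite <- subst_scons0. apply prv_all0E.
  exact (prv_all0E _ _ _ t H).
Qed.

Lemma prv_BIM Γ A : BIM A -> Γ ⊢ A.
Proof. intros H; apply prv_axiom; now left. Qed.

Lemma prv_rewrite Γ A t u X Y :
  (Γ ⊢ t ≐ u) -> inst0 t A = X -> inst0 u A = Y -> (Γ ⊢ X) -> Γ ⊢ Y.
Proof. intros H <- <-; now apply prv_eq0_subst. Qed.

Lemma inst0_lift0 t A : inst0 t (lift0 A) = A.
Proof.
  unfold inst0, lift0; rewrite subst_comp. rewrite <- (subst_id A) at 2; f_equal.
Qed.

Lemma tsubst_tlift0 t u : tsubst (scons u Var) FVar (tlift0 t) = t.
Proof. unfold tlift0; rewrite tsubst_comp; apply tsubst_id. Qed.

Lemma prv_sym Γ t u : (Γ ⊢ t ≐ u) -> Γ ⊢ u ≐ t.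
Proof.
  intros H; eapply (prv_rewrite Γ (#0 ≐ tlift0 t)); [exact H| | |apply (prv_eq0_refl _ _ t)];
    cbn; now rewrite tsubst_tlift0.
Qed.

Lemma prv_trans Γ t u v : (Γ ⊢ t ≐ u) -> (Γ ⊢ u ≐ v) -> Γ ⊢ t ≐ v.
Proof.
  intros H K; eapply (prv_rewrite Γ (tlift0 t ≐ #0)); [exact K| | |exact H];
    cbn; now rewrite tsubst_tlift0.
Qed.

Lemma prv_congr_App Γ F t u : (Γ ⊢ t ≐ u) -> Γ ⊢ F @ t ≐ F @ u.
Proof.
  intros H; eapply (prv_rewrite Γ (F @ tlift0 t ≐ F @ #0));
    [exact H| | |apply (prv_eq0_refl _ _ (F @ t))];
    cbn; now rewrite tsubst_tlift0, fsubst_id.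
Qed.

Lemma prv_congr_J Γ t u t' u' :
  (Γ ⊢ t ≐ t') -> (Γ ⊢ u ≐ u') -> Γ ⊢ J t u ≐ J t' u'.
Proof.
  intros H K; apply prv_trans with (J t' u).
  - eapply (prv_rewrite Γ (J (tlift0 t) (tlift0 u) ≐ J #0 (tlift0 u)));
    [exact H| | |apply (prv_eq0_refl _ _ (J t u))]; cbn; now rewrite !tsubst_tlift0.
  - eapply (prv_rewrite Γ (J (tlift0 t') (tlift0 u) ≐ J (tlift0 t') #0));
    [exact K| | |apply (prv_eq0_refl _ _ (J t' u))]; cbn; now rewrite !tsubst_tlift0.
Qed.

Lemma prv_ind Γ A :
  (Γ ⊢ inst0 Zero A) ->
  (A :: map lift0 Γ ⊢ subst (scons (Succ #0) (fun i => #(S i))) FVar A) ->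
  Γ ⊢ ∀₀ A.
Proof.
  intros H0 HS; eapply prv_impE; [apply prv_BIM, bim_ind|].
  apply prv_andI; [exact H0|]. now apply prv_all0I, prv_impI.
Qed.

Lemma closed_weakening Γ A : ([] ⊢ A) -> Γ ⊢ A.
Proof. intros H; eapply weakening; [exact H|intros ? []]. Qed.

Lemma prv_succ_neq0 Γ t : (Γ ⊢ Succ t ≐ Zero) -> Γ ⊢ Bot.
Proof.
  intros H; apply (prv_impE _ _ (Succ t ≐ Zero)); [|exact H].
  apply (prv_instE0 _ _ t) with (1 := prv_BIM _ _ bim_succ_neq0); reflexivity.
Qed.

Lemma prv_succ_inj Γ t u : (Γ ⊢ Succ t ≐ Succ u) -> Γ ⊢ t ≐ u.
Proof.
  intros H; apply (prv_impE _ _ (Succ t ≐ Succ u)); [|exact H].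
  exact (prv_instE00 _ _ t u _ (prv_BIM _ _ bim_succ_inj) eq_refl).
Qed.

(** Double induction, with the outer hypothesis universal in the second number. The decisions made
    later all rest on this one. *)
Lemma prv_eq_dec Γ t u : Γ ⊢ t ≐ u ⊔ Not (t ≐ u).
Proof.
  assert (H : [] ⊢ ∀₀ ∀₀ #1 ≐ #0 ⊔ Not (#1 ≐ #0)).
  { apply prv_ind.
    - apply prv_ind; compute_subst.
      + apply prv_orI1, prv_eq0_refl.
      + apply prv_orI2, prv_impI, (prv_succ_neq0 _ #0), prv_sym; hyp.
    - apply prv_ind; compute_subst.
      + apply prv_orI2, prv_impI, (prv_succ_neq0 _ #0); hyp.
      + apply prv_orE with (#1 ≐ #0) (Not (#1 ≐ #0)).
        * eapply (prv_instE0 _ _ #0); [|]; [hyp|reflexivity].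
        * apply prv_orI1, prv_congr_App; hyp.
        * apply prv_orI2, prv_impI, (prv_impE _ _ (#1 ≐ #0)); [hyp|].
          apply prv_succ_inj; hyp. }
  exact (prv_instE00 _ _ t u _ (closed_weakening _ _ H) eq_refl).
Qed.

(** By extensionality [Eq1] is a universal statement in disguise; it is therefore left out of the
    decidable formulas. *)
Inductive quantifier_free : form -> Prop :=
| qf_bot : quantifier_free Bot
| qf_eq t u : quantifier_free (t ≐ u)
| qf_and A B : quantifier_free A -> quantifier_free B -> quantifier_free (A ⊓ B)
| qf_or A B : quantifier_free A -> quantifier_free B -> quantifier_free (A ⊔ B)
| qf_imp A B : quantifier_free A -> quantifier_free B -> quantifier_free (A ⇒ B).

Lemma qf_dec A : quantifier_free A -> forall Γ, Γ ⊢ A ⊔ Not A.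
Proof.
  intros H; induction H as [|t u|A B _ IHA _ IHB|A B _ IHA _ IHB|A B _ IHA _ IHB]; intros Γ.
  - apply prv_orI2, prv_impI; hyp.
  - apply prv_eq_dec.
  - apply prv_orE with A (Not A); [apply IHA| |].
    + apply prv_orE with B (Not B); [apply IHB| |].
      * apply prv_orI1, prv_andI; hyp.
      * apply prv_orI2, prv_impI, (prv_impE _ _ B); [hyp|].
        apply (prv_andE2 _ _ A); hyp.
    + apply prv_orI2, prv_impI, (prv_impE _ _ A); [hyp|].
      apply (prv_andE1 _ _ _ B); hyp.
  - apply prv_orE with A (Not A); [apply IHA| |].
    + apply prv_orI1, prv_orI1; hyp.
    + apply prv_orE with B (Not B); [apply IHB| |].
      * apply prv_orI1, prv_orI2; hyp.
      * apply prv_orI2, prv_impI, (prv_orE _ _ A B); [hyp| |].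
        -- apply (prv_impE _ _ A); hyp.
        -- apply (prv_impE _ _ B); hyp.
  - apply prv_orE with B (Not B); [apply IHB| |].
    + apply prv_orI1, prv_impI; hyp.
    + apply prv_orE with A (Not A); [apply IHA| |].
      * apply prv_orI2, prv_impI, (prv_impE _ _ B); [hyp|].
        apply (prv_impE _ _ A); hyp.
      * apply prv_orI1, prv_impI, prv_botE, (prv_impE _ _ A); hyp.
Qed.

(* If a decidable property holds at 0 but not everywhere, then it is lost between some u and u + 1; unlike induction, this is a statement without implications between undecided formulas. *)
Lemma prv_last_instance Γ A : (forall Γ, Γ ⊢ A ⊔ Not A) ->
  (Γ ⊢ inst0 Zero A) ->
  Γ ⊢ ∀₀ A ⊔ lift0 (∃₀ A ⊓ Not (subst (scons (Succ #0) (fun i => #(S i))) FVar A)).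
Proof.
  intros dec H0. set (B := subst (scons _ _) _ A). set (E := ∃₀ A ⊓ Not B).
  assert (decS : forall Γ, Γ ⊢ B ⊔ Not B).
  { intros Γ'; apply closed_weakening.
    apply (prv_subst _ _ _ theory_subst_closed (dec [])
             (scons (Succ #0) (fun i => #(S i))) FVar). }
  apply prv_ind.
  - cbn [inst0 subst]. unfold inst0 in *; cbn [subst].
    apply prv_orI1; exact H0.
  - cbn [subst]. fold B.
    replace (subst _ _ (lift0 E)) with (lift0 E)
      by (unfold lift0; now rewrite subst_comp).
    apply prv_orE with A (lift0 E); [hyp| |].
    + apply prv_orE with B (Not B); [apply decS|apply prv_orI1; hyp|].
      apply prv_orI2.
      change (lift0 E) with (∃₀ (subst (up0 (fun i => #(S i))) FVar (A ⊓ Not B))).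
      apply (prv_ex0I _ _ _ #0). rewrite subst_scons0.
      assert (Hs : (scons #0 (fun i => #(S i))) = Var)
        by (extensionality i; now destruct i).
      rewrite Hs, subst_id. apply prv_andI; hyp.
    + apply prv_orI2; hyp.
Qed.

(** Constant symbols do not take numerical parameters, so the value is reached by induction inside
    BIM, composing with the successor. This is how parameters enter functions, in the models and in
    the sections used for IRT. *)
Lemma prv_constant_function Γ : Γ ⊢ ∀₀ ∃₁ ∀₀ $0 @ #0 ≐ #1.
Proof.
  apply prv_ind.
  - apply (prv_ex1I _ _ _ (FConst CZero)), prv_BIM, bim_zero.
  - compute_subst.
    eapply prv_ex1E; [hyp|]; compute_subst.
    eapply prv_ex1E.
    { eapply (prv_instE1 _ _ $0).
      - eapply (prv_instE1 _ _ (FConst CSucc)); [apply prv_BIM, bim_cl_comp|reflexivity].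
      - reflexivity. }
    compute_subst. apply (prv_ex1I _ _ _ $0); compute_subst.
    apply prv_all0I; compute_subst.
    apply prv_trans with (Succ ($1 @ #0)).
    + apply (prv_instE0 _ ($0 @ #0 ≐ Succ ($1 @ #0)) #0); [hyp|reflexivity].
    + apply prv_congr_App.
      apply (prv_instE0 _ ($1 @ #0 ≐ #2) #0); [hyp|reflexivity].
Qed.

(** * Classical models *)

Record structure := {
  carrier :> Type;
  zero : carrier;
  pair : carrier -> carrier -> carrier;
  cst : const -> carrier -> carrier;
  Fn : (carrier -> carrier) -> Prop
}.

Arguments zero {s}.
Arguments pair {s}.
Arguments cst {s}.
Arguments Fn {s}.

Definition feval {M : structure} (ψ : nat -> M -> M) (F : fn) : M -> M :=
  match F with FVar i => ψ i | FConst c => cst c end.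

Fixpoint teval {M : structure} (φ : nat -> M) (ψ : nat -> M -> M) (t : tm) : M :=
  match t with
  | Var i => φ i
  | Zero => zero
  | App F t => feval ψ F (teval φ ψ t)
  | J t u => pair (teval φ ψ t) (teval φ ψ u)
  end.

Fixpoint holds {M : structure} (φ : nat -> M) (ψ : nat -> M -> M) (A : form) : Prop :=
  match A with
  | Bot => False
  | Eq0 t u => teval φ ψ t = teval φ ψ u
  | Eq1 F G => forall x, feval ψ F x = feval ψ G x
  | And A B => holds φ ψ A /\ holds φ ψ B
  | Or A B => holds φ ψ A \/ holds φ ψ B
  | Imp A B => holds φ ψ A -> holds φ ψ B
  | All0 A => forall x, holds (scons x φ) ψ A
  | Ex0 A => exists x, holds (scons x φ) ψ A
  | All1 A => forall f, Fn f -> holds φ (scons f ψ) A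
  | Ex1 A => exists f, Fn f /\ holds φ (scons f ψ) A
  end.

(* [Dec_const] is harmless because the metatheory is classical. *)
Inductive Dec {M : structure} : (M -> Prop) -> Prop :=
| Dec_const (P : Prop) : Dec (fun _ => P)
| Dec_eq f g : Fn f -> Fn g -> Dec (fun x => f x = g x)
| Dec_and P Q : Dec P -> Dec Q -> Dec (fun x => P x /\ Q x)
| Dec_or P Q : Dec P -> Dec Q -> Dec (fun x => P x \/ Q x)
| Dec_imp P Q : Dec P -> Dec Q -> Dec (fun x => P x -> Q x).

Definition succ {M : structure} : M -> M := cst CSucc.

Record is_model (M : structure) : Prop := {
  m_id : forall x : M, cst CId x = x;
  m_zero : forall x : M, cst CZero x = zero;
  m_succ_neq0 : forall x : M, succ x <> zero;
  m_succ_inj : forall x y : M, succ x = succ y -> x = y;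
  m_J00 : pair zero zero = zero :> M;
  m_J0S : forall x : M, pair zero (succ x) = succ (pair x zero);
  m_JS : forall x y : M, pair (succ x) y = succ (pair x (succ y));
  m_K : forall x y : M, cst CK (pair x y) = x;
  m_L : forall x y : M, cst CL (pair x y) = y;
  m_comp : forall f g (x : M), cst (CComp f g) x = cst f (cst g x);
  m_pair : forall f g (x : M), cst (CPair f g) x = pair (cst f x) (cst g x);
  m_rec0 : forall f g (x : M), cst (CRec f g) (pair x zero) = cst f x;
  m_recS : forall f g (x y : M), cst (CRec f g) (pair x (succ y)) =
             cst g (pair (pair x y) (cst (CRec f g) (pair x y)));
  m_Fn_cst : forall c, Fn (@cst M c);
  m_Fn_const : forall p : M, Fn (fun _ : M => p);
  m_Fn_comp : forall f g : M -> M, Fn f -> Fn g -> Fn (fun x => f (g x));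
  m_Fn_pair : forall f g : M -> M, Fn f -> Fn g -> Fn (fun x => pair (f x) (g x));
  m_Fn_rec : forall f g : M -> M, Fn f -> Fn g -> exists h, Fn h /\
    forall x, h (pair x zero) = f x /\
      forall y, h (pair x (succ y)) = g (pair (pair x y) (h (pair x y)));
  m_ind : forall P : M -> Prop, Dec P -> P zero ->
    (forall x, P x -> P (succ x)) -> forall x, P x
}.

(** * The term model of a saturated set *)

Section Canonical.

Context (Δ : form -> Prop) (HΔ : saturated Δ).

Lemma sat_nil A : ([] ⊢ A) -> Δ A.
Proof. apply (sat_prv _ HΔ []); intros ? []. Qed.

Lemma sat_one A B : ([A] ⊢ B) -> Δ A -> Δ B.
Proof. intros H HA; apply (sat_prv _ HΔ [A]); [now intros ? [<-|[]]|exact H]. Qed.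

Lemma sat_two A B C : ([A; B] ⊢ C) -> Δ A -> Δ B -> Δ C.
Proof.
  intros H HA HB; apply (sat_prv _ HΔ [A; B]); [now intros ? [<-|[<-|[]]]|exact H].
Qed.

Lemma sat_mp A B : Δ (A ⇒ B) -> Δ A -> Δ B.
Proof. apply sat_two. eapply prv_impE; hyp. Qed.

Lemma sat_sym t u : Δ (t ≐ u) -> Δ (u ≐ t).
Proof. apply sat_one, prv_sym; hyp. Qed.

Lemma sat_trans t u v : Δ (t ≐ u) -> Δ (u ≐ v) -> Δ (t ≐ v).
Proof. apply sat_two, prv_trans with u; hyp. Qed.

Definition tclass (t : tm) : tm -> Prop := fun u => Δ (t ≐ u).

(** The quotient of the terms by equality in Δ. Classes are taken as predicates, so that equality in
    the model is Rocq's own equality. *)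
Definition classes : Type := {P : tm -> Prop | exists t, P = tclass t}.

Definition cl (t : tm) : classes := exist _ (tclass t) (ex_intro _ t eq_refl).

Lemma cl_eq t u : cl t = cl u <-> Δ (t ≐ u).
Proof.
  split; intros H.
  - assert (K : tclass t u) by (apply (f_equal (@proj1_sig _ _)) in H; cbn in H;
      rewrite H; apply sat_nil, prv_eq0_refl).
    exact K.
  - apply eq_sig_hprop; [intros; apply proof_irrelevance|]; cbn.
    extensionality v; apply propositional_extensionality; split; intros K.
    + apply sat_trans with t; [now apply sat_sym|exact K].
    + now apply sat_trans with u.
Qed.

Lemma cl_surj (x : classes) : exists t, x = cl t.
Proof.
  destruct x as [P [t ->]]; exists t.
  apply eq_sig_hprop; [intros; apply proof_irrelevance|reflexivity].
Qed.

Definition rep (x : classes) : tm := epsilon (inhabits Zero) (fun t => x = cl t).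

Lemma cl_rep x : cl (rep x) = x.
Proof. symmetry; apply (epsilon_spec (inhabits Zero) (fun t => x = cl t)), cl_surj. Qed.

Definition fclass (F : fn) (x : classes) : classes := cl (F @ rep x).

Definition canonical : structure := {|
  carrier := classes;
  zero := cl Zero;
  pair := fun x y => cl (J (rep x) (rep y));
  cst := fun c => fclass (FConst c);
  Fn := fun f => exists F, f = fclass F
|}.

Lemma fclass_cl F t : fclass F (cl t) = cl (F @ t).
Proof.
  apply cl_eq; eapply sat_one; [apply prv_congr_App; hyp|].
  apply cl_eq, cl_rep.
Qed.

Lemma pair_cl t u : @pair canonical (cl t) (cl u) = cl (J t u).
Proof.
  apply cl_eq; eapply sat_two; [apply prv_congr_J; hyp| |];
    apply cl_eq, cl_rep.
Qed.

Lemma teval_cl σ τ t :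
  @teval canonical (fun i => cl (σ i)) (fun i => fclass (τ i)) t = cl (tsubst σ τ t).
Proof.
  induction t as [i| |F t IH|t IHt u IHu]; cbn [teval tsubst]; auto.
  - rewrite IH. destruct F; apply fclass_cl.
  - rewrite IHt, IHu; apply pair_cl.
Qed.

Definition holds_cl (σ : nat -> tm) (τ : nat -> fn) (A : form) : Prop :=
  @holds canonical (fun i => cl (σ i)) (fun i => fclass (τ i)) A.

Lemma holds_cl_scons0 σ τ t A :
  @holds canonical (scons (cl t) (fun i => cl (σ i))) (fun i => fclass (τ i)) A
  <-> holds_cl (scons t σ) τ A.
Proof.
  unfold holds_cl.
  replace (fun i => cl (scons t σ i)) with (scons (cl t) (fun i => cl (σ i)));
    [reflexivity|]. extensionality i; now destruct i.
Qed.

Lemma holds_cl_scons1 σ τ F A :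
  @holds canonical (fun i => cl (σ i)) (scons (fclass F) (fun i => fclass (τ i))) A
  <-> holds_cl σ (scons F τ) A.
Proof.
  unfold holds_cl.
  replace (fun i => fclass (scons F τ i)) with (scons (fclass F) (fun i => fclass (τ i)));
    [reflexivity|]. extensionality i; now destruct i.
Qed.

Lemma holds_cl_ex0 σ τ A :
  holds_cl σ τ (∃₀ A) <-> exists t, holds_cl (scons t σ) τ A.
Proof.
  split.
  - intros [x Hx]; destruct (cl_surj x) as [t ->]; exists t.
    now apply holds_cl_scons0.
  - intros [t Ht]; exists (cl t); now apply holds_cl_scons0.
Qed.

Lemma holds_cl_all0 σ τ A :
  holds_cl σ τ (∀₀ A) <-> forall t, holds_cl (scons t σ) τ A.
Proof.
  split.
  - intros H t; apply holds_cl_scons0, H.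
  - intros H x; destruct (cl_surj x) as [t ->]. now apply holds_cl_scons0.
Qed.

Lemma holds_cl_ex1 σ τ A :
  holds_cl σ τ (∃₁ A) <-> exists F, holds_cl σ (scons F τ) A.
Proof.
  split.
  - intros (f & [F ->] & H); exists F; now apply holds_cl_scons1.
  - intros [F H]; exists (fclass F); split; [now exists F|]; now apply holds_cl_scons1.
Qed.

Lemma holds_cl_all1 σ τ A :
  holds_cl σ τ (∀₁ A) <-> forall F, holds_cl σ (scons F τ) A.
Proof.
  split.
  - intros H F; apply holds_cl_scons1, H; now exists F.
  - intros H f [F ->]; now apply holds_cl_scons1.
Qed.

End Canonical.

(* In a canonical model, membership in the saturated set and truth agree only for part of the formulas; [true_prv] and [prv_true] are the two directions. *)
Definition true_prv (A : form) : Prop := forall Δ, saturated Δ ->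
  forall σ τ, holds_cl Δ σ τ A -> Δ (subst σ τ A).

Definition prv_true (A : form) : Prop := forall Δ, saturated Δ ->
  forall σ τ, Δ (subst σ τ A) -> holds_cl Δ σ τ A.

Definition decided (A : form) : Prop := forall Δ, saturated Δ ->
  forall σ τ, Δ (subst σ τ A) \/ Δ (Not (subst σ τ A)).

Create HintDb truth.

(** * Transfer between provability and truth *)

Lemma true_prv_bot : true_prv Bot.
Proof. intros Δ HΔ σ τ []. Qed.

Lemma prv_true_bot : prv_true Bot.
Proof. intros Δ HΔ σ τ H; exact (sat_bot _ HΔ H). Qed.

Lemma true_prv_eq t u : true_prv (t ≐ u).
Proof.
  intros Δ HΔ σ τ H; apply (cl_eq Δ HΔ). rewrite <- !teval_cl by assumption; exact H.
Qed.

Lemma prv_true_eq t u : prv_true (t ≐ u).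
Proof.
  intros Δ HΔ σ τ H; apply (cl_eq Δ HΔ) in H; unfold holds_cl; cbn [holds].
  now rewrite !teval_cl.
Qed.

Lemma true_prv_and A B : true_prv A -> true_prv B -> true_prv (A ⊓ B).
Proof.
  intros HA HB Δ HΔ σ τ [H K].
  apply (sat_two Δ HΔ (subst σ τ A) (subst σ τ B)); [apply prv_andI; hyp| |];
    [now apply HA|now apply HB].
Qed.

Lemma prv_true_and A B : prv_true A -> prv_true B -> prv_true (A ⊓ B).
Proof.
  intros HA HB Δ HΔ σ τ H; split; [apply HA; auto|apply HB; auto];
    (eapply (sat_one Δ HΔ); [|exact H]);
    [eapply prv_andE1; hyp|eapply prv_andE2; hyp].
Qed.

Lemma true_prv_or A B : true_prv A -> true_prv B -> true_prv (A ⊔ B).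
Proof.
  intros HA HB Δ HΔ σ τ [H|H]; [apply HA in H|apply HB in H]; auto;
    (eapply (sat_one Δ HΔ); [|exact H]); [apply prv_orI1; hyp|apply prv_orI2; hyp].
Qed.

Lemma prv_true_or A B : prv_true A -> prv_true B -> prv_true (A ⊔ B).
Proof.
  intros HA HB Δ HΔ σ τ H; apply (sat_or _ HΔ) in H as [H|H];
    [left; now apply HA|right; now apply HB].
Qed.

Lemma prv_true_imp A B : true_prv A -> prv_true B -> prv_true (A ⇒ B).
Proof.
  intros HA HB Δ HΔ σ τ H K; apply HB; auto.
  apply (sat_mp Δ HΔ (subst σ τ A)); [exact H|now apply HA].
Qed.

(** A provable antecedent makes the consequent true and hence provable; a refuted one gives the
    implication by ex falso. Without a decision in Δ, truth of the implication would say nothing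
    about its provability. *)
Lemma true_prv_imp A B :
  decided A -> prv_true A -> true_prv B -> true_prv (A ⇒ B).
Proof.
  intros D HA HB Δ HΔ σ τ H; destruct (D Δ HΔ σ τ) as [K|K].
  - apply HA, H, HB in K; auto. eapply (sat_one Δ HΔ); [apply prv_impI; hyp|exact K].
  - eapply (sat_one Δ HΔ); [|exact K].
    apply prv_impI, prv_botE, (prv_impE _ _ (subst σ τ A)); hyp.
Qed.

Lemma prv_true_all0 A : prv_true A -> prv_true (∀₀ A).
Proof.
  intros HA Δ HΔ σ τ H; apply holds_cl_all0; intros t; apply HA; auto.
  rewrite <- subst_scons0.
  eapply (sat_one Δ HΔ); [|exact H]. apply prv_all0E; hyp.
Qed.

Lemma prv_true_all1 A : prv_true A -> prv_true (∀₁ A).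
Proof.
  intros HA Δ HΔ σ τ H; apply holds_cl_all1; intros F; apply HA; auto.
  rewrite <- subst_scons1.
  eapply (sat_one Δ HΔ); [|exact H]. apply prv_all1E; hyp.
Qed.

Lemma true_prv_ex0 A : true_prv A -> true_prv (∃₀ A).
Proof.
  intros HA Δ HΔ σ τ H; apply holds_cl_ex0 in H as [t H]; apply HA in H; auto.
  rewrite <- subst_scons0 in H.
  eapply (sat_one Δ HΔ); [|exact H]. eapply prv_ex0I; hyp.
Qed.

Lemma prv_true_ex0 A : prv_true A -> prv_true (∃₀ A).
Proof.
  intros HA Δ HΔ σ τ H; apply (sat_ex0 _ HΔ) in H as [t H].
  rewrite subst_scons0 in H. apply holds_cl_ex0; exists t; now apply HA.
Qed.

Lemma true_prv_ex1 A : true_prv A -> true_prv (∃₁ A).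
Proof.
  intros HA Δ HΔ σ τ H; apply holds_cl_ex1 in H as [t H]; apply HA in H; auto.
  rewrite <- subst_scons1 in H.
  eapply (sat_one Δ HΔ); [|exact H]. eapply prv_ex1I; hyp.
Qed.

Lemma prv_true_ex1 A : prv_true A -> prv_true (∃₁ A).
Proof.
  intros HA Δ HΔ σ τ H; apply (sat_ex1 _ HΔ) in H as [t H].
  rewrite subst_scons1 in H. apply holds_cl_ex1; exists t; now apply HA.
Qed.

Lemma decided_dec A : (forall Γ, Γ ⊢ A ⊔ Not A) -> decided A.
Proof.
  intros H Δ HΔ σ τ; apply (sat_or _ HΔ), (sat_nil _ HΔ).
  exact (prv_subst _ _ _ theory_subst_closed (H []) σ τ).
Qed.

Lemma decided_eq t u : decided (t ≐ u).
Proof. apply decided_dec; intros; apply prv_eq_dec. Qed.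

#[global] Hint Resolve true_prv_bot prv_true_bot true_prv_eq prv_true_eq
  true_prv_and prv_true_and true_prv_or prv_true_or prv_true_imp true_prv_imp
  prv_true_all0 prv_true_all1 true_prv_ex0 prv_true_ex0 true_prv_ex1 prv_true_ex1
  decided_eq : truth.

Ltac truth := cbn; unfold Not, Iff; auto 100 with truth nocore.

Lemma qf_decided A : quantifier_free A -> decided A.
Proof. intros H; apply decided_dec; now apply qf_dec. Qed.

(** This turns predicates on the model back into formulas, to which the induction of BIM applies.
    Functions in [Fn] are classes of function terms, so an equation between them is an atomic
    formula. *)
Lemma Dec_canonical Δ (HΔ : saturated Δ) (P : canonical Δ -> Prop) : Dec P ->
  exists A, quantifier_free A /\ forall t, P (cl Δ t) <-> Δ (inst0 t A).
Proof.
  intros H; induction H as [P|f g [F ->] [G ->]|P Q _ (A & qA & HA) _ (B & qB & HB)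
    |P Q _ (A & qA & HA) _ (B & qB & HB)|P Q _ (A & qA & HA) _ (B & qB & HB)].
  - destruct (classic P) as [H|H].
    + exists (Zero ≐ Zero); split; [constructor|]; intros t; split; auto.
      intros _; apply (sat_nil _ HΔ), prv_eq0_refl.
    + exists Bot; split; [constructor|]; intros t; split; [tauto|].
      intros K; destruct (sat_bot _ HΔ K).
  - exists (F @ #0 ≐ G @ #0); split; [constructor|]; intros t.
    rewrite !fclass_cl by assumption.
    replace (inst0 t _) with (F @ t ≐ G @ t); [apply (cl_eq Δ HΔ)|].
    destruct F, G; reflexivity.
  - exists (A ⊓ B); split; [now constructor|]; intros t.
    rewrite HA, HB; unfold inst0; cbn [subst]; split.
    + intros [H K]; eapply (sat_two _ HΔ); [apply prv_andI; hyp|exact H|exact K].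
    + intros H; split; eapply (sat_one _ HΔ); try exact H;
        [eapply prv_andE1; hyp|eapply prv_andE2; hyp].
  - exists (A ⊔ B); split; [now constructor|]; intros t.
    rewrite HA, HB; unfold inst0; cbn [subst]; split; [|apply (sat_or _ HΔ)].
    intros [H|H]; eapply (sat_one _ HΔ); try exact H;
      [apply prv_orI1; hyp|apply prv_orI2; hyp].
  - exists (A ⇒ B); split; [now constructor|]; intros t.
    rewrite HA, HB; unfold inst0; cbn [subst]; split; [|apply (sat_mp _ HΔ)].
    intros H. destruct (qf_decided _ qA Δ HΔ (scons t Var) FVar) as [K|K].
    + eapply (sat_one _ HΔ); [apply prv_impI|exact (H K)]; hyp.
    + eapply (sat_one _ HΔ); [|exact K].
      apply prv_impI, prv_botE, (prv_impE _ _ (subst (scons t Var) FVar A)); hyp.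
Qed.

Lemma holds_axiom Δ (HΔ : saturated Δ) A :
  prv_true A -> ([] ⊢ A) -> holds_cl Δ Var FVar A.
Proof. intros HA H; apply HA; auto. rewrite subst_id. now apply sat_nil. Qed.

Lemma canonical_model Δ : saturated Δ -> is_model (canonical Δ).
Proof.
  intros HΔ.
  assert (ax : forall A, BIM A -> prv_true A -> holds_cl Δ Var FVar A)
    by (intros; apply holds_axiom; auto using prv_BIM).
  split.
  - exact (ax _ bim_id ltac:(truth)).
  - exact (ax _ bim_zero ltac:(truth)).
  - exact (ax _ bim_succ_neq0 ltac:(truth)).
  - exact (ax _ bim_succ_inj ltac:(truth)).
  - exact (ax _ bim_J00 ltac:(truth)).
  - exact (ax _ bim_J0S ltac:(truth)).
  - exact (ax _ bim_JS ltac:(truth)).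
  - exact (ax _ bim_K ltac:(truth)).
  - exact (ax _ bim_L ltac:(truth)).
  - intros f g; exact (ax _ (bim_comp f g) ltac:(truth)).
  - intros f g; exact (ax _ (bim_pair f g) ltac:(truth)).
  - intros f g; exact (ax _ (bim_rec0 f g) ltac:(truth)).
  - intros f g; exact (ax _ (bim_recS f g) ltac:(truth)).
  - intros c; now exists (FConst c).
  - intros p.
    destruct (holds_axiom _ HΔ (∀₀ ∃₁ ∀₀ $0 @ #0 ≐ #1) ltac:(truth)
      (prv_constant_function []) p) as (f & Hf & E).
    replace (fun _ => p) with f; [exact Hf|]. extensionality x; apply (E x).
  - intros f g Hf Hg.
    destruct (ax _ bim_cl_comp ltac:(truth) f Hf g Hg) as (h & Hh & E).
    replace (fun x => f (g x)) with h; [exact Hh|]. extensionality x; apply (E x).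
  - intros f g Hf Hg.
    destruct (ax _ bim_cl_pair ltac:(truth) f Hf g Hg) as (h & Hh & E).
    replace (fun x => pair (f x) (g x)) with h; [exact Hh|]. extensionality x; apply (E x).
  - intros f g Hf Hg; exact (ax _ bim_cl_rec ltac:(truth) f Hf g Hg).
  (* The induction axiom does not apply directly: that the step holds at every element does not put
     the universal implication into Δ. [prv_last_instance] has an existential conclusion instead,
     and its witness contradicts the step. *)
  - intros P HP H0 HS x. apply NNPP; intros Hx.
    destruct (Dec_canonical Δ HΔ P HP) as (A & qA & HA).
    destruct (cl_surj Δ x) as [t ->].
    change (P (cl Δ Zero)) in H0. apply HA in H0.
    assert (K : Δ (inst0 t (A ⊔ lift0 (∃₀ A ⊓ Not (subst (scons (Succ #0) (fun i => #(S i))) FVar A))))).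
    { eapply (sat_one _ HΔ); [|exact H0]. apply prv_all0E, prv_last_instance; [|hyp].
      now apply qf_dec. }
    unfold inst0 in K; cbn [subst] in K; apply (sat_or _ HΔ) in K as [K|K];
      [now apply HA in K|].
    change (Δ (inst0 t (lift0 (∃₀ A ⊓ Not (subst (scons (Succ #0) (fun i => #(S i))) FVar A))))) in K.
    rewrite inst0_lift0 in K.
    apply (sat_ex0 _ HΔ) in K as [u K].
    apply (sat_bot _ HΔ).
    assert (K1 : Δ (inst0 u A)) by (eapply (sat_one _ HΔ); [eapply prv_andE1; hyp|exact K]).
    assert (K2 : Δ (inst0 (Succ u) A)).
    { apply HA in K1; apply HS in K1. apply HA.
      unfold Succ; rewrite <- (fclass_cl Δ HΔ (FConst CSucc) u); exact K1. }
    eapply (sat_two _ HΔ); [|exact K|exact K2].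
    eapply prv_impE; [eapply prv_andE2; hyp|].
    rewrite subst_comp; apply prv_hyp; right; left.
    unfold inst0; f_equal. extensionality i; destruct i; reflexivity.
Qed.

(* Completeness for sequents whose antecedents are [prv_true] and whose succedent is [true_prv]. *)

Definition assignment {M : structure} (ψ : nat -> M -> M) : Prop := forall i, Fn (ψ i).

Lemma by_models Γ A :
  (forall B, In B Γ -> prv_true B) -> true_prv A ->
  (forall M : structure, is_model M -> forall (φ : nat -> M) ψ, assignment ψ ->
     (forall B, In B Γ -> holds φ ψ B) -> holds φ ψ A) ->
  Γ ⊢ A.
Proof.
  intros HΓ HA H; apply NNPP; intros K.
  destruct (saturated_extension Γ A K) as (Δ & HΔ & ΔΓ & ΔA); apply ΔA.
  rewrite <- subst_id; apply HA; auto.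
  apply H; [now apply canonical_model| |].
  - intros i; now exists (FVar i).
  - intros B HB; apply (HΓ B HB); auto. rewrite subst_id; auto.
Qed.

(** * Arithmetic in models *)

Existing Class is_model.

(** Truncated subtraction turns the order, which is defined by an existential formula, into an
    equation and so opens it to induction. *)
Definition CSub : const := CRec CId (CComp CPred (CPair CZero CL)).

Section Arithmetic.

Context {M : structure} {HM : is_model M}.
Implicit Types x y z : M.

Definition add x y : M := cst CPlus (pair x y).
Definition pred x : M := cst CPred (pair zero x).
Definition sub x y : M := cst CSub (pair x y).
Definition le x y : Prop := exists z, add x z = y.
Definition lt x y : Prop := le (succ x) y.

Lemma Fn_id : Fn (fun x : M => x).
Proof.
  replace (fun x : M => x) with (@cst M CId); [apply (m_Fn_cst _ HM)|].
  extensionality x; apply (m_id _ HM).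
Qed.

Lemma add_0_r x : add x zero = x.
Proof. unfold add, CPlus; rewrite (m_rec0 _ HM); apply (m_id _ HM). Qed.

Lemma add_S_r x y : add x (succ y) = succ (add x y).
Proof. unfold add, CPlus; rewrite (m_recS _ HM), (m_comp _ HM), (m_L _ HM); reflexivity. Qed.

Lemma pred_0 : pred zero = zero.
Proof. unfold pred, CPred; rewrite (m_rec0 _ HM); apply (m_zero _ HM). Qed.

Lemma pred_S x : pred (succ x) = x.
Proof.
  unfold pred, CPred; now rewrite (m_recS _ HM), (m_comp _ HM), (m_K _ HM), (m_L _ HM).
Qed.

Lemma sub_0_r x : sub x zero = x.
Proof. unfold sub, CSub; rewrite (m_rec0 _ HM); apply (m_id _ HM). Qed.

Lemma sub_S_r x y : sub x (succ y) = pred (sub x y).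
Proof.
  unfold sub, CSub; now rewrite (m_recS _ HM), (m_comp _ HM), (m_pair _ HM),
    (m_zero _ HM), (m_L _ HM).
Qed.

End Arithmetic.

Ltac unfold_terms := unfold add, pred, sub, succ.

Ltac solve_Fn :=
  cbv beta;
  lazymatch goal with
  | |- Fn (fun x => x) => exact Fn_id
  | |- Fn (fun _ => ?p) => exact (m_Fn_const _ _ p)
  | |- Fn (fun x => pair (@?f x) (@?g x)) => apply (m_Fn_pair _ _ f g); solve_Fn
  | |- Fn (fun x => cst ?c (@?g x)) =>
      apply (m_Fn_comp _ _ (cst c) g); [exact (m_Fn_cst _ _ c)|solve_Fn]
  | |- Fn (fun x => ?h (@?g x)) => apply (m_Fn_comp _ _ h g); [solve_Fn|solve_Fn]
  | |- Fn (cst ?c) => exact (m_Fn_cst _ _ c)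
  | |- Fn ?f => assumption
  end.

Ltac solve_Dec :=
  cbv beta;
  lazymatch goal with
  | |- Dec (fun _ => ?P) => exact (Dec_const P)
  | |- Dec (fun x => (@?P x) /\ (@?Q x)) => apply (Dec_and P Q); solve_Dec
  | |- Dec (fun x => (@?P x) \/ (@?Q x)) => apply (Dec_or P Q); solve_Dec
  | |- Dec (fun x => (@?P x) -> (@?Q x)) => apply (Dec_imp P Q); solve_Dec
  | |- Dec (fun x => ~ (@?P x)) => apply (Dec_imp P (fun _ => False)); solve_Dec
  | |- Dec (fun x => (@?f x) = (@?g x)) => apply (Dec_eq f g); unfold_terms; solve_Fn
  end.

(** The predicate is read off the goal and must be recognised syntactically as [Dec]; this is why
    definitions are unfolded before the call in the proofs below. *)
Ltac ind x :=
  pattern x;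
  lazymatch goal with
  | |- ?P x => revert x; refine (m_ind _ _ P _ _ _); [solve_Dec| |]; cbv beta
  end.

(** * Addition, truncated subtraction and the linear order *)

Section Order.

Context {M : structure} {HM : is_model M}.
Implicit Types x y z : M.

Lemma add_0_l x : add zero x = x.
Proof.
  ind x; [apply add_0_r|]. intros x IH; now rewrite add_S_r, IH.
Qed.

Lemma add_S_l x y : add (succ x) y = succ (add x y).
Proof.
  ind y; [now rewrite !add_0_r|]. intros y IH; now rewrite !add_S_r, IH.
Qed.

Lemma add_comm x y : add x y = add y x.
Proof.
  ind y; [now rewrite add_0_l, add_0_r|]. intros y IH; now rewrite add_S_l, add_S_r, IH.
Qed.

Lemma add_assoc x y z : add x (add y z) = add (add x y) z.
Proof.
  ind z; [now rewrite !add_0_r|]. intros z IH; now rewrite !add_S_r, IH.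
Qed.

Lemma add_cancel_r x y z : add x z = add y z -> x = y.
Proof.
  ind z; [now rewrite !add_0_r|].
  intros z IH H; rewrite !add_S_r in H; apply IH; exact (m_succ_inj _ HM _ _ H).
Qed.

Lemma zero_or_succ x : x = zero \/ x = succ (pred x).
Proof.
  ind x; [now left|]. intros x _; right; now rewrite pred_S.
Qed.

Lemma sub_SS x y : sub (succ x) (succ y) = sub x y.
Proof.
  ind y; [now rewrite sub_S_r, !sub_0_r, pred_S|].
  intros y IH; now rewrite sub_S_r, IH, sub_S_r.
Qed.

Lemma sub_diag x : sub x x = zero.
Proof. ind x; [apply sub_0_r|]. intros x IH; now rewrite sub_SS. Qed.

Lemma add_sub x z : sub (add x z) x = z.
Proof.
  ind x; [now rewrite sub_0_r, add_0_l|].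
  intros x IH; now rewrite add_S_l, sub_SS.
Qed.

Lemma sub_add x z : sub x (add x z) = zero.
Proof.
  ind z; [now rewrite add_0_r, sub_diag|].
  intros z IH; now rewrite add_S_r, sub_S_r, IH, pred_0.
Qed.

(** Totality of the order with its witnesses written as terms: only in this form is it open to
    induction as long as [le] is not known to be [Dec]. *)
Lemma add_sub_or x y : x = add y (sub x y) \/ y = add x (sub y x).
Proof.
  ind y; [left; now rewrite sub_0_r, add_0_l|].
  intros y [IH|IH].
  - destruct (zero_or_succ (sub x y)) as [E|E].
    + right. rewrite E, add_0_r in IH; subst x.
      assert (H : succ y = add y (succ zero)) by now rewrite add_S_r, add_0_r.
      now rewrite H, add_sub.
    + left. rewrite sub_S_r, add_S_l, <- add_S_r, <- E; exact IH.
  - right. assert (H : succ y = add x (succ (sub y x))) by now rewrite add_S_r, <- IH.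
    now rewrite H, add_sub.
Qed.

Lemma le_total x y : le x y \/ le y x.
Proof.
  destruct (add_sub_or x y) as [E|E]; [right|left]; eexists; symmetry; exact E.
Qed.

Lemma le_refl x : le x x.
Proof. exists zero; apply add_0_r. Qed.

Lemma le_sub x y : le x y <-> sub x y = zero.
Proof.
  split; [intros [z <-]; apply sub_add|].
  intros H; destruct (le_total x y) as [K|[z <-]]; [exact K|].
  rewrite add_sub in H; subst z; rewrite add_0_r; apply le_refl.
Qed.

Lemma Dec_le (f g : M -> M) : Fn f -> Fn g -> Dec (fun x => le (f x) (g x)).
Proof.
  intros Hf Hg. replace (fun x => le (f x) (g x)) with (fun x => sub (f x) (g x) = zero).
  - solve_Dec.
  - extensionality x; apply propositional_extensionality; now rewrite le_sub.
Qed.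

Lemma le_trans x y z : le x y -> le y z -> le x z.
Proof. intros [a <-] [b <-]; exists (add a b); apply add_assoc. Qed.

Lemma add_eq_0 x y : add x y = zero -> x = zero /\ y = zero.
Proof.
  intros H. destruct (zero_or_succ y) as [->|E].
  - now rewrite add_0_r in H.
  - rewrite E, add_S_r in H; now apply (m_succ_neq0 _ HM) in H.
Qed.

Lemma le_antisym x y : le x y -> le y x -> x = y.
Proof.
  intros [a <-] [b E]. rewrite <- add_assoc in E.
  assert (H : add a b = zero).
  { apply (add_cancel_r _ _ x). now rewrite add_0_l, add_comm. }
  apply add_eq_0 in H as [-> _]; symmetry; apply add_0_r.
Qed.

Lemma le_0_l x : le zero x.
Proof. exists x; apply add_0_l. Qed.

Lemma le_S_S x y : le (succ x) (succ y) <-> le x y.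
Proof. rewrite !le_sub, sub_SS; reflexivity. Qed.

Lemma lt_S_r x y : lt x (succ y) <-> le x y.
Proof. apply le_S_S. Qed.

Lemma lt_S x : lt x (succ x).
Proof. apply le_refl. Qed.

Lemma lt_le x y : lt x y -> le x y.
Proof. intros [z <-]; exists (succ z); now rewrite add_S_r, add_S_l. Qed.

Lemma not_lt_0 x : ~ lt x zero.
Proof. intros [z H]; rewrite add_S_l in H; now apply (m_succ_neq0 _ HM) in H. Qed.

Lemma lt_irrefl x : ~ lt x x.
Proof.
  intros [z H]. apply (m_succ_neq0 _ HM z).
  rewrite add_S_l, <- add_S_r in H. apply (add_cancel_r _ _ x).
  now rewrite add_comm, H, add_0_l.
Qed.

Lemma le_lt_trans x y z : le x y -> lt y z -> lt x z.
Proof. intros H; apply le_trans; now apply le_S_S. Qed.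

Lemma lt_le_trans x y z : lt x y -> le y z -> lt x z.
Proof. apply le_trans. Qed.

Lemma lt_trans x y z : lt x y -> lt y z -> lt x z.
Proof. intros H K; apply (le_lt_trans _ y); [now apply lt_le|exact K]. Qed.

Lemma le_cases x y : le x y -> lt x y \/ x = y.
Proof.
  intros [z <-]; destruct (zero_or_succ z) as [->|E].
  - right; now rewrite add_0_r.
  - left; exists (pred z). rewrite E at 2. now rewrite add_S_l, add_S_r.
Qed.

Lemma lt_S_cases x y : lt x (succ y) -> lt x y \/ x = y.
Proof. intros H; apply le_cases; now apply lt_S_r. Qed.

Lemma le_or_lt x y : le x y \/ lt y x.
Proof.
  destruct (le_total x y) as [H|H]; [now left|].
  apply le_cases in H as [H| ->]; [now right|left; apply le_refl].
Qed.

Lemma le_not_lt x y : le x y -> ~ lt y x.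
Proof. intros H K; apply (lt_irrefl x); now apply (le_lt_trans _ y). Qed.

Lemma lt_trichotomy x y : lt x y \/ x = y \/ lt y x.
Proof.
  destruct (le_or_lt x y) as [H|H]; [apply le_cases in H|]; tauto.
Qed.

Lemma pos_succ x : lt zero x -> x = succ (pred x).
Proof.
  intros H; destruct (zero_or_succ x) as [->|E]; [now apply lt_irrefl in H|exact E].
Qed.

Lemma le_add_l x y : le x (add x y).
Proof. now exists y. Qed.

Lemma le_add_r x y : le y (add x y).
Proof. rewrite add_comm; apply le_add_l. Qed.

Lemma add_le_mono x y x' y' : le x x' -> le y y' -> le (add x y) (add x' y').
Proof.
  intros [a <-] [b <-]. exists (add a b).
  rewrite <- !add_assoc; f_equal. rewrite !add_assoc; f_equal. apply add_comm.
Qed.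

Lemma sub_pos x y : lt x y -> sub y x = succ (sub y (succ x)).
Proof.
  intros [z <-]. rewrite add_sub. rewrite add_S_l, <- add_S_r, add_sub; reflexivity.
Qed.

Lemma sub_sub x y : le x y -> sub y (sub y x) = x.
Proof.
  intros [z <-]; rewrite add_sub, add_comm; apply add_sub.
Qed.

End Order.

Ltac solve_Dec ::=
  cbv beta;
  lazymatch goal with
  | |- Dec (fun _ => ?P) => exact (Dec_const P)
  | |- Dec (fun x => (@?P x) /\ (@?Q x)) => apply (Dec_and P Q); solve_Dec
  | |- Dec (fun x => (@?P x) \/ (@?Q x)) => apply (Dec_or P Q); solve_Dec
  | |- Dec (fun x => (@?P x) -> (@?Q x)) => apply (Dec_imp P Q); solve_Dec
  | |- Dec (fun x => ~ (@?P x)) => apply (Dec_imp P (fun _ => False)); solve_Dec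
  | |- Dec (fun x => (@?f x) = (@?g x)) => apply (Dec_eq f g); unfold_terms; solve_Fn
  | |- Dec (fun x => lt (@?f x) (@?g x)) =>
      apply (Dec_le (fun x => succ (f x)) g); unfold_terms; solve_Fn
  | |- Dec (fun x => le (@?f x) (@?g x)) => apply (Dec_le f g); unfold_terms; solve_Fn
  end.

(** * Pairs and finite sequences in models *)

Definition CTail : const := CRec CZero (CPair (CComp CK CK) CL).

Section Sequences.

Context {M : structure} {HM : is_model M}.
Implicit Types x y z a b c s t u i j n : M.

(** On the diagonal of sum n, each increase of the first entry raises the code by one. Monotonicity
    of the pairing is obtained from this description. *)
Lemma pair_sub a n : le a n -> pair a (sub n a) = add (pair zero n) a.
Proof.
  ind a.
  - intros _; now rewrite sub_0_r, add_0_r.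
  - intros a IH H. rewrite (m_JS _ HM), <- (sub_pos _ _ H), IH by now apply lt_le.
    now rewrite add_S_r.
Qed.

Lemma pair_add a b : pair a b = add (pair zero (add a b)) a.
Proof. rewrite <- pair_sub by apply le_add_l. now rewrite add_sub. Qed.

Lemma pair_0_mono n m : le n m -> le (pair zero n) (pair zero m).
Proof.
  intros [z <-]; ind z; [rewrite add_0_r; apply le_refl|].
  intros z IH. apply (le_trans _ _ _ IH).
  rewrite add_S_r, (m_J0S _ HM), (pair_add (add n z) zero), add_0_r.
  apply lt_le, lt_S_r, le_add_l.
Qed.

Lemma pair_mono a b a' b' : le a a' -> le b b' -> le (pair a b) (pair a' b').
Proof.
  intros Ha Hb; rewrite (pair_add a b), (pair_add a' b').
  apply add_le_mono; [|exact Ha]. apply pair_0_mono; now apply add_le_mono.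
Qed.

Lemma le_pair_l a b : le a (pair a b).
Proof. rewrite pair_add; apply le_add_r. Qed.

Lemma le_pair_r a b : le b (pair a b).
Proof.
  assert (H : forall n, le n (pair zero n)).
  { intros n; ind n; [apply le_0_l|]. intros n IH.
    rewrite (m_J0S _ HM), (pair_add n zero), add_0_r; apply le_S_S, le_add_r. }
  rewrite pair_add. apply (le_trans _ (add a b)); [apply le_add_r|].
  apply (le_trans _ _ _ (H _)), le_add_l.
Qed.

(** The axioms for K and L speak of pairs only. Surjectivity follows by running through Cantor's
    enumeration: the successor of a pair is the next one on its diagonal or, when the second entry
    is 0, the first one of the next diagonal. *)
Lemma pair_eta x : x = pair (cst CK x) (cst CL x).
Proof.
  ind x.
  - rewrite <- (m_J00 _ HM) at 2 3. now rewrite (m_K _ HM), (m_L _ HM), (m_J00 _ HM).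
  - intros x IH. set (a := cst CK x) in *; set (b := cst CL x) in *; clearbody a b; subst x.
    destruct (zero_or_succ b) as [->|E].
    + now rewrite <- (m_J0S _ HM), (m_K _ HM), (m_L _ HM).
    + rewrite E, <- (m_JS _ HM), (m_K _ HM), (m_L _ HM); reflexivity.
Qed.

Lemma K_le x : le (cst CK x) x.
Proof. rewrite (pair_eta x) at 2; apply le_pair_l. Qed.

Lemma L_le x : le (cst CL x) x.
Proof. rewrite (pair_eta x) at 2; apply le_pair_r. Qed.

Lemma K_0 : cst CK zero = zero :> M.
Proof. rewrite <- (m_J00 _ HM) at 1; apply (m_K _ HM). Qed.

Lemma L_0 : cst CL zero = zero :> M.
Proof. rewrite <- (m_J00 _ HM) at 1; apply (m_L _ HM). Qed.

Definition len s : M := cst CK s.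
Definition ent s i : M := cst CEntry (pair s i).
Definition iterL s i : M := cst CIterL (pair s i).
Definition isq s : Prop := iterL s (succ (len s)) = zero.

Lemma iterL_0 s : iterL s zero = s.
Proof. unfold iterL, CIterL; rewrite (m_rec0 _ HM); apply (m_id _ HM). Qed.

Lemma iterL_S s i : iterL s (succ i) = cst CL (iterL s i).
Proof. unfold iterL, CIterL; now rewrite (m_recS _ HM), (m_comp _ HM), (m_L _ HM). Qed.

Lemma ent_iterL s i : ent s i = cst CK (iterL s (succ i)).
Proof. rewrite iterL_S; unfold ent, CEntry; now rewrite !(m_comp _ HM). Qed.

Lemma iterL_step s i : iterL s (succ i) = pair (ent s i) (iterL s (succ (succ i))).
Proof. rewrite (pair_eta (iterL s (succ i))), ent_iterL, (iterL_S _ (succ i)); reflexivity. Qed.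

Lemma sub_le n d : le (sub n d) n.
Proof.
  destruct (add_sub_or n d) as [F|F]; [rewrite F at 2; apply le_add_r|].
  rewrite F, sub_add; apply le_0_l.
Qed.

Lemma isq_ext a b : isq a -> isq b -> len a = len b ->
  (forall i, lt i (len a) -> ent a i = ent b i) -> a = b.
Proof.
  unfold isq; intros Ha Hb E H; rewrite <- E in Hb; set (n := len a) in *.
  (* The tails are compared from the end: for d = 0 both are 0 by [isq], and each step prepends one
     entry. *)
  assert (K : forall d, iterL a (succ (sub n d)) = iterL b (succ (sub n d))).
  { intros d; unfold iterL; ind d; fold iterL.
    - rewrite sub_0_r; unfold iterL in *; now rewrite Ha, Hb.
    - intros d IH. destruct (zero_or_succ (sub n d)) as [Z|Z].
      + rewrite Z in IH; now rewrite sub_S_r, Z, pred_0.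
      + rewrite sub_S_r. set (e := pred (sub n d)) in *; rewrite Z in IH.
        fold (iterL a (succ e)) (iterL b (succ e)).
        rewrite (iterL_step a), (iterL_step b), H; [unfold iterL; now rewrite IH|].
        unfold lt; rewrite <- Z. 
        apply sub_le. }
  specialize (K n); rewrite sub_diag, !iterL_S, !iterL_0 in K.
  rewrite (pair_eta a), (pair_eta b), K; unfold n, len in E; now rewrite E.
Qed.

(** The tail after the last entry is 0, and 0 is the pair of 0 with itself. This default will act as
    colour 0. *)
Lemma ent_beyond s i : isq s -> le (len s) i -> ent s i = zero.
Proof.
  intros H [z <-]. rewrite ent_iterL.
  assert (K : iterL s (succ (add (len s) z)) = zero).
  { unfold iterL; ind z.
    - rewrite add_0_r; exact H.
    - intros z IH. rewrite add_S_r. fold (iterL s (succ (succ (add (len s) z)))).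
      rewrite iterL_S; unfold iterL; rewrite IH; apply L_0. }
  rewrite K; apply K_0.
Qed.

Lemma ent_le s i : le (ent s i) s.
Proof.
  rewrite ent_iterL. apply (le_trans _ _ _ (K_le _)).
  generalize (succ i); clear i; intros i; unfold iterL. ind i.
  - change (le (iterL s zero) s); rewrite iterL_0; apply le_refl.
  - intros i IH. change (le (iterL s (succ i)) s); rewrite iterL_S.
    exact (le_trans _ _ _ (L_le _) IH).
Qed.

Lemma seq_of_fun (f : M -> M) n : Fn f ->
  exists c, isq c /\ len c = n /\ forall i, lt i n -> ent c i = f i.
Proof.
  intros Hf.
  (* The code is built from its end: for d at most n, h(n, d) is the tail with entries f(n - d),
     ..., f(n - 1). *)
  destruct (m_Fn_rec _ HM (fun _ => zero)
    (fun z => pair (f (sub (cst CK (cst CK z)) (succ (cst CL (cst CK z))))) (cst CL z)))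
    as (h & Hh & E); [solve_Fn|unfold_terms; solve_Fn|].
  assert (E0 : forall x, h (pair x zero) = zero) by (intros; apply E).
  assert (ES : forall x y,
    h (pair x (succ y)) = pair (f (sub x (succ y))) (h (pair x y))).
  { intros x y; destruct (E x) as [_ H]; rewrite (H y).
    now rewrite !(m_K _ HM), !(m_L _ HM). }
  exists (pair n (h (pair n n))); set (c := pair _ _).
  assert (Hl : len c = n) by apply (m_K _ HM).
  assert (H : forall i, iterL c (succ i) = h (pair n (sub n i))).
  { intros i; unfold iterL; ind i.
    - change (iterL c (succ zero) = h (pair n (sub n zero))).
      rewrite iterL_S, iterL_0, sub_0_r; apply (m_L _ HM).
    - intros i IH. change (iterL c (succ (succ i)) = h (pair n (sub n (succ i)))).
      rewrite iterL_S; unfold iterL; rewrite IH, sub_S_r.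
      destruct (zero_or_succ (sub n i)) as [Z|Z].
      + now rewrite Z, pred_0, E0, L_0.
      + rewrite Z at 1; now rewrite ES, (m_L _ HM). }
  split; [|split].
  - unfold isq; now rewrite Hl, H, sub_diag, E0.
  - exact Hl.
  - intros i Hi. rewrite ent_iterL, H, (sub_pos _ _ Hi), ES, (m_K _ HM).
    rewrite <- (sub_pos _ _ Hi), sub_sub; [reflexivity|now apply lt_le].
Qed.

(** [tail_bound a n] is the tail of the code of the constant sequence a of length n, and
    [seq_bound a n] is one more than this code. As pairing is monotone, it bounds all sequences of
    length n with entries at most a. *)
Definition tail_bound a n : M := cst CTail (pair a n).
Definition seq_bound a n : M := succ (pair n (tail_bound a n)).

Lemma tail_bound_S a n : tail_bound a (succ n) = pair a (tail_bound a n).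
Proof.
  unfold tail_bound, CTail; rewrite (m_recS _ HM).
  now rewrite (m_pair _ HM), (m_comp _ HM), !(m_K _ HM), (m_L _ HM).
Qed.

Lemma lt_seq_bound s a n : isq s -> len s = n ->
  (forall i, lt i n -> le (ent s i) a) -> lt s (seq_bound a n).
Proof.
  intros Hs Hn H.
  (* Again from the end of the sequence; once [sub n d] has reached 0, only the bound grows. *)
  assert (K : forall d, le (iterL s (succ (sub n d))) (tail_bound a d)).
  { intros d; unfold iterL, tail_bound; ind d.
    - rewrite sub_0_r, <- Hn. unfold isq, iterL in Hs; rewrite Hs; apply le_0_l.
    - intros d IH.
      change (le (iterL s (succ (sub n d))) (tail_bound a d)) in IH.
      change (le (iterL s (succ (sub n (succ d)))) (tail_bound a (succ d))).
      rewrite tail_bound_S, sub_S_r.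
      destruct (zero_or_succ (sub n d)) as [Z|Z].
      + rewrite Z in IH |- *; rewrite pred_0.
        exact (le_trans _ _ _ IH (le_pair_r _ _)).
      + rewrite iterL_step. rewrite Z in IH. apply pair_mono; [|exact IH].
        apply H. unfold lt; rewrite <- Z; apply sub_le. }
  specialize (K n); rewrite sub_diag, iterL_S, iterL_0 in K.
  apply lt_S_r. rewrite (pair_eta s). unfold len in Hn; rewrite Hn.
  apply pair_mono; [apply le_refl|exact K].
Qed.

End Sequences.

(** * Predicates defined uniformly by constants *)

(** The constant is chosen before the model. Only then can it be written into a formula whose
    derivability is tested in all canonical models. *)
Definition CFun (f : forall M : structure, M -> M) : Prop :=
  exists c, forall M, is_model M -> forall x, cst c x = f M x.

Definition CDef (P : forall M : structure, M -> Prop) : Prop :=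
  exists c, forall M, is_model M -> forall x, P M x <-> cst c x = zero.

Lemma CFun_id : CFun (fun M x => x).
Proof. exists CId; intros; now apply m_id. Qed.

Lemma CFun_zero : CFun (fun M x => zero).
Proof. exists CZero; intros; now apply m_zero. Qed.

Lemma CFun_cst d f : CFun f -> CFun (fun M x => cst d (f M x)).
Proof. intros [c H]; exists (CComp d c); intros M HM x. now rewrite m_comp, H. Qed.

Lemma CFun_comp f g : CFun f -> CFun g -> CFun (fun M x => f M (g M x)).
Proof. intros [c H] [d K]; exists (CComp c d); intros M HM x. now rewrite m_comp, K, H. Qed.

Lemma CFun_pair f g : CFun f -> CFun g -> CFun (fun M x => pair (f M x) (g M x)).
Proof. intros [c H] [d K]; exists (CPair c d); intros M HM x. now rewrite m_pair, H, K. Qed.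

Lemma CDef_ext P Q :
  (forall M, is_model M -> forall x : M, P M x <-> Q M x) -> CDef Q -> CDef P.
Proof. intros E [c H]; exists c; intros; now rewrite E, H. Qed.

Lemma CDef_le f g : CFun f -> CFun g -> CDef (fun M x => le (f M x) (g M x)).
Proof.
  intros [c H] [d K]; exists (CComp CSub (CPair c d)); intros M HM x.
  now rewrite m_comp, m_pair, H, K, le_sub.
Qed.

Lemma CDef_and P Q : CDef P -> CDef Q -> CDef (fun M x => P M x /\ Q M x).
Proof.
  intros [c H] [d K]; exists (CComp CPlus (CPair c d)); intros M HM x.
  rewrite m_comp, m_pair, H, K by assumption.
  change (cst CPlus (pair (cst c x) (cst d x))) with (add (cst c x) (cst d x)).
  split; [intros [-> ->]; apply add_0_r|apply add_eq_0].
Qed.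

Lemma CDef_eq f g : CFun f -> CFun g -> CDef (fun M x => f M x = g M x).
Proof.
  intros Hf Hg; apply (CDef_ext _ (fun M x => le (f M x) (g M x) /\ le (g M x) (f M x))).
  - intros M HM x; split; [intros ->; split; apply le_refl|intros []; now apply le_antisym].
  - apply CDef_and; now apply CDef_le.
Qed.

Lemma CDef_not P : CDef P -> CDef (fun M x => ~ P M x).
Proof.
  intros [c H]. apply (CDef_ext _ (fun M x => lt zero (cst c x))).
  - intros M HM x; rewrite H by assumption; split.
    + intros K. destruct (zero_or_succ (cst c x)) as [E|E]; [contradiction|].
      rewrite E; apply lt_S_r, le_0_l.
    + intros K E; rewrite E in K; now apply lt_irrefl in K.
  - apply (CDef_le (fun M x => succ zero)); apply CFun_cst; [apply CFun_zero|apply CFun_id].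
Qed.

Lemma CDef_imp P Q : CDef P -> CDef Q -> CDef (fun M x => P M x -> Q M x).
Proof.
  intros HP HQ; apply (CDef_ext _ (fun M x => ~ (P M x /\ ~ Q M x))).
  - intros M _ x; split; [tauto|]. intros H HPx; apply NNPP; tauto.
  - apply CDef_not, CDef_and, CDef_not; assumption.
Qed.

Lemma CDef_or P Q : CDef P -> CDef Q -> CDef (fun M x => P M x \/ Q M x).
Proof.
  intros HP HQ; apply (CDef_ext _ (fun M x => ~ (~ P M x /\ ~ Q M x))).
  - intros; tauto.
  - apply CDef_not, CDef_and; now apply CDef_not.
Qed.

(* [CSum c] sums the values of [c] over the last argument; the sum vanishes exactly when all the values do. *)
Definition CSum (c : const) : const := CRec CZero (CComp CPlus (CPair CL (CComp c CK))).

Lemma CSum_zero c (M : structure) (HM : is_model M) (x n : M) :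
  cst (CSum c) (pair x n) = zero <-> forall i, lt i n -> cst c (pair x i) = zero.
Proof.
  set (h n := cst (CSum c) (pair x n)).
  assert (E0 : h zero = zero) by (unfold h, CSum; rewrite m_rec0; now rewrite ?m_zero).
  assert (ES : forall n, h (succ n) = add (h n) (cst c (pair x n))).
  { intros m; unfold h, CSum; rewrite m_recS by assumption.
    now rewrite m_comp, m_pair, m_comp, m_L, m_K. }
  change (h n = zero <-> forall i, lt i n -> cst c (pair x i) = zero). split.
  - intros H i; revert H; unfold h. ind n.
    + intros _ H; now apply not_lt_0 in H.
    + intros n IH H; fold (h n) in IH; fold (h (succ n)) in H. rewrite ES in H.
      apply add_eq_0 in H as [H1 H2]; intros K.
      apply lt_S_cases in K as [K| ->]; auto.
  - intros H.
    assert (K : forall m, le m n -> h m = zero).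
    { intros m; unfold h; ind m; [intros _; exact E0|].
      intros m IH Hm. fold (h (succ m)). rewrite ES, H by exact Hm.
      rewrite add_0_r; apply IH; now apply lt_le. }
    apply K, le_refl.
Qed.

Lemma CDef_ball b (P : forall M : structure, M -> M -> Prop) : CFun b ->
  CDef (fun M z => P M (cst CK z) (cst CL z)) ->
  CDef (fun M x => forall i, lt i (b M x) -> P M x i).
Proof.
  intros [d K] [c H]; exists (CComp (CSum c) (CPair CId d)); intros M HM x.
  rewrite m_comp, m_pair, m_id, K, CSum_zero by assumption.
  split; intros E i Hi; specialize (E i Hi).
  - apply H; auto. now rewrite m_K, m_L.
  - apply H in E; auto. now rewrite m_K, m_L in E.
Qed.

Lemma CDef_bex b (P : forall M : structure, M -> M -> Prop) : CFun b ->
  CDef (fun M z => P M (cst CK z) (cst CL z)) ->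
  CDef (fun M x => exists i, lt i (b M x) /\ P M x i).
Proof.
  intros Hb HP; apply (CDef_ext _ (fun M x => ~ forall i, lt i (b M x) -> ~ P M x i)).
  - intros M HM x; split; [intros (i & Hi & H) K; exact (K i Hi H)|].
    intros H; apply NNPP; intros K; apply H; intros i Hi Hp; apply K; eauto.
  - apply CDef_not, CDef_ball; [exact Hb|].
    apply (CDef_not (fun M z => P M (cst CK z) (cst CL z))); exact HP.
Qed.

Ltac solve_CFun :=
  cbv beta;
  lazymatch goal with
  | |- CFun (fun M x => x) => exact CFun_id
  | |- CFun (fun M x => zero) => exact CFun_zero
  | |- CFun (fun M x => pair (@?f M x) (@?g M x)) => apply (CFun_pair f g); solve_CFun
  | |- CFun (fun M x => cst ?c (@?f M x)) => apply (CFun_cst c f); solve_CFun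
  | |- CFun (fun M x => ?f M (@?g M x)) => apply (CFun_comp f g); solve_CFun
  | |- CFun ?f => assumption
  end.

Ltac unfold_cterms := unfold seq_bound, tail_bound, len, ent, iterL, add, pred, sub, succ.

Create HintDb cdef.

Ltac solve_CDef :=
  cbv beta;
  lazymatch goal with
  | |- CDef (fun M x => (@?P M x) /\ (@?Q M x)) => apply (CDef_and P Q); solve_CDef
  | |- CDef (fun M x => (@?P M x) \/ (@?Q M x)) => apply (CDef_or P Q); solve_CDef
  | |- CDef (fun M x => ~ (@?P M x)) => apply (CDef_not P); solve_CDef
  | |- CDef (fun M x => (@?P M x) -> (@?Q M x)) => apply (CDef_imp P Q); solve_CDef
  | |- CDef (fun M x => forall i, lt i (@?b M x) -> @?P M x i) =>
      apply (CDef_ball b P); [unfold_cterms; solve_CFun|solve_CDef]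
  | |- CDef (fun M x => exists i, lt i (@?b M x) /\ @?P M x i) =>
      apply (CDef_bex b P); [unfold_cterms; solve_CFun|solve_CDef]
  | |- CDef (fun M x => (@?f M x) = (@?g M x)) =>
      apply (CDef_eq f g); unfold_cterms; solve_CFun
  | |- CDef (fun M x => lt (@?f M x) (@?g M x)) =>
      apply (CDef_le (fun M x => succ (f M x)) g); unfold_cterms; solve_CFun
  | |- CDef (fun M x => le (@?f M x) (@?g M x)) =>
      apply (CDef_le f g); unfold_cterms; solve_CFun
  | |- _ => solve [auto 3 with cdef nocore]
  end.

(** * Colourings in models *)

Section Notions.

Context {M : structure}.
Implicit Types c s t u v x y k l m n r : M.

Definition incr s k : Prop := isq s /\ len s = k /\
  forall j i, lt j i -> lt i k -> lt (ent s j) (ent s i).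

Definition incr_below s m k : Prop := incr s k /\ lt (ent s (pred k)) m.

Definition composite x t s : Prop := isq x /\ len x = len s /\
  forall i, lt i (len s) -> ent x i = ent t (ent s i).

Definition homog c s l k : Prop := forall u v,
  incr_below u l k -> incr_below v l k -> exists x y,
  composite x s u /\ composite y s v /\ ent c x = ent c y.

Definition hit m n k c : Prop := exists l s,
  lt zero l /\ incr_below s m l /\ le n l /\ le (ent s zero) l /\ homog c s l k.

(** A code of any length serves as a colouring: tuples beyond its length receive the default entry
    0, which is a legitimate colour among r + 1. This is what allows colourings to be cut off or
    padded. *)
Definition bad r k n m c : Prop :=
  isq c /\ (forall i, lt i (len c) -> lt (ent c i) (succ r)) /\ ~ hit m n k c.

Definition good r k n m : Prop := forall c, ~ bad r k n m c.

Definition least_bad r k n m c : Prop :=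
  bad r k n m c /\ forall d, lt d c -> ~ bad r k n m d.

Definition restr y x k : Prop := isq y /\ len y = k /\
  forall j, lt j k -> ent y j = ent x j.

(* With m the last entry of x, [above] says that m is good or that the least bad colouring for m gives the other entries of x a colour that is at least i. *)
Definition above r k n i x : Prop := good r k n (ent x k) \/
  exists c, least_bad r k n (ent x k) c /\ exists y, restr y x k /\ le i (ent c y).

Definition differs r k n i x : Prop := good r k n (ent x k) \/
  exists c, least_bad r k n (ent x k) c /\ exists y, restr y x k /\ ent c y <> i.

End Notions.

Section Combinatorics.

Context {M : structure} {HM : is_model M}.
Implicit Types c s t u v x y k l m n r i j p : M.

Lemma incr_below_entries s m k : incr_below s m k ->
  forall i, lt i k -> lt (ent s i) m.
Proof.
  intros [(Hs & Hl & H) Hm] i Hi.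
  assert (E : k = succ (pred k)) by (apply pos_succ; exact (le_lt_trans _ _ _ (le_0_l _) Hi)).
  rewrite E in Hi; apply lt_S_cases in Hi as [Hi| ->]; [|exact Hm].
  apply (lt_trans _ (ent s (pred k))); [|exact Hm].
  apply H; [exact Hi|]. rewrite E at 2; apply lt_S.
Qed.

Lemma incr_below_pos s m k : incr_below s m k -> lt zero m.
Proof. intros [_ H]; exact (le_lt_trans _ _ _ (le_0_l _) H). Qed.

Lemma incr_ge_index s k : incr s k -> forall i, lt i k -> le i (ent s i).
Proof.
  intros (Hs & Hl & H) i; unfold ent; ind i; [intros _; apply le_0_l|].
  intros i IH Hi. apply (lt_le_trans _ (succ (ent s i))).
  - apply le_S_S, IH. exact (lt_trans _ _ _ (lt_S _) Hi).
  - apply H; [apply lt_S|exact Hi].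
Qed.

Lemma incr_below_length s m l : incr_below s m l -> le l m.
Proof.
  intros H; destruct (zero_or_succ l) as [->|E]; [apply le_0_l|].
  rewrite E. apply (le_lt_trans _ (ent s (pred l))).
  - apply (incr_ge_index s l); [apply H|]. rewrite E at 2; apply lt_S.
  - apply H.
Qed.

Lemma incr_below_bound s m k : incr_below s m k -> lt s (seq_bound m k).
Proof.
  intros H; apply lt_seq_bound; try apply H.
  intros i Hi; apply lt_le, (incr_below_entries s m k); auto.
Qed.

Lemma composite_bound x t s : composite x t s -> lt x (seq_bound t (len s)).
Proof.
  intros (Hx & Hl & H); apply lt_seq_bound; auto.
  intros i Hi; rewrite H by exact Hi; apply ent_le.
Qed.

Lemma composite_exists t s : exists x, composite x t s.
Proof.
  destruct (seq_of_fun (fun i => ent t (ent s i)) (len s)) as (x & Hx & Hl & H);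
    [unfold ent; solve_Fn|]. now exists x.
Qed.

Lemma restr_unique x y z k : restr x z k -> restr y z k -> x = y.
Proof.
  intros (Hx & Lx & Ex) (Hy & Ly & Ey); apply isq_ext; auto; [congruence|].
  intros i Hi; rewrite Lx in Hi; now rewrite Ex, Ey.
Qed.

Lemma restr_bound y x k : restr y x k -> lt y (seq_bound x k).
Proof.
  intros (Hx & Hl & H); apply lt_seq_bound; auto.
  intros i Hi; rewrite H by exact Hi; apply ent_le.
Qed.

Lemma restr_exists x k : exists y, restr y x k.
Proof.
  destruct (seq_of_fun (fun i => ent x i) k) as (y & H); [unfold ent; solve_Fn|].
  now exists y.
Qed.

Lemma composite_incr_below x s u m l k :
  composite x s u -> incr_below s m l -> incr_below u l k -> incr_below x m k.
Proof.
  intros (Hx & Lx & Ex) Hs Hu.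
  pose proof (incr_below_entries _ _ _ Hs) as Es.
  pose proof (incr_below_entries _ _ _ Hu) as Eu.
  pose proof (incr_below_pos _ _ _ Hs) as Hm.
  destruct Hu as [(Qu & Lu & Iu) _], Hs as [(Qs & Ls & Is) _].
  rewrite Lu in Lx, Ex. split; [split; [exact Hx|split; [exact Lx|]]|].
  - intros j i Hji Hi. rewrite (Ex i Hi), (Ex j (lt_trans _ _ _ Hji Hi)).
    apply Is; [now apply Iu|now apply Eu].
  - destruct (zero_or_succ k) as [->|E].
    (* For k = 0 the condition on the last entry reads the default 0 at [pred zero] and amounts to m
       being positive. *)
    + rewrite ent_beyond; auto. rewrite Lx; apply le_0_l.
    + assert (Hp : lt (pred k) k) by (rewrite E at 2; apply lt_S).
      rewrite Ex by exact Hp. auto.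
Qed.

End Combinatorics.

(** * Constants for the notions about colourings *)

Lemma CDef_incr s k : CFun s -> CFun k -> CDef (fun M x => incr (s M x) (k M x)).
Proof.
  intros Hs Hk. apply (CDef_ext _ (fun M x => isq (s M x) /\ len (s M x) = k M x /\
    forall i, lt i (k M x) -> forall j, lt j i -> lt (ent (s M x) j) (ent (s M x) i))).
  - intros M HM x; split; intros (H1 & H2 & H3); split; [|split| |split]; eauto.
  - unfold isq; solve_CDef.
Qed.

Lemma CDef_incr_below s m k : CFun s -> CFun m -> CFun k ->
  CDef (fun M x => incr_below (s M x) (m M x) (k M x)).
Proof.
  intros; apply CDef_and; [now apply CDef_incr|]. solve_CDef.
Qed.

Lemma CDef_composite x t s : CFun x -> CFun t -> CFun s ->
  CDef (fun M z => composite (x M z) (t M z) (s M z)).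
Proof. intros; unfold composite, isq; solve_CDef. Qed.

Lemma CDef_restr y x k : CFun y -> CFun x -> CFun k ->
  CDef (fun M z => restr (y M z) (x M z) (k M z)).
Proof. intros; unfold restr, isq; solve_CDef. Qed.

#[global] Hint Resolve CDef_incr_below CDef_composite CDef_restr : cdef.
#[global] Hint Extern 0 (CFun _) => unfold_cterms; solve_CFun : cdef.

(** All quantifiers have computable bounds: u and v are k-tuples below l, and the entries of x and
    y, being entries of s, are at most the code s. *)
Lemma CDef_homog c s l k : CFun c -> CFun s -> CFun l -> CFun k ->
  CDef (fun M x => homog (c M x) (s M x) (l M x) (k M x)).
Proof.
  intros Hc Hs Hl Hk. apply (CDef_ext _ (fun M x =>
    forall u, lt u (seq_bound (l M x) (k M x)) -> incr_below u (l M x) (k M x) ->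
    forall v, lt v (seq_bound (l M x) (k M x)) -> incr_below v (l M x) (k M x) ->
    exists a, lt a (seq_bound (s M x) (len u)) /\ composite a (s M x) u /\
    exists b, lt b (seq_bound (s M x) (len v)) /\ composite b (s M x) v /\
      ent (c M x) a = ent (c M x) b)).
  - intros M HM x; split.
    + intros H u _ Hu v _ Hv; destruct (H u v Hu Hv) as (a & b & Ha & Hb & E).
      exists a; repeat split; [now apply composite_bound|apply Ha..|].
      exists b; repeat split; [now apply composite_bound|apply Hb..|exact E].
    + intros H u v Hu Hv.
      destruct (H u (incr_below_bound _ _ _ Hu) Hu v (incr_below_bound _ _ _ Hv) Hv)
        as (a & _ & Ha & b & _ & Hb & E).
      now exists a, b.
  - solve_CDef.
Qed.

#[global] Hint Resolve CDef_homog : cdef.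

Lemma CDef_hit m n k c : CFun m -> CFun n -> CFun k -> CFun c ->
  CDef (fun M x => hit (m M x) (n M x) (k M x) (c M x)).
Proof.
  intros Hm Hn Hk Hc. apply (CDef_ext _ (fun M x =>
    exists l, lt l (succ (m M x)) /\ lt zero l /\ le (n M x) l /\
    exists s, lt s (seq_bound (m M x) l) /\
      incr_below s (m M x) l /\ le (ent s zero) l /\ homog (c M x) s l (k M x))).
  - intros M HM x; split.
    + intros (l & s & H0 & Hs & H1 & H2 & H3).
      exists l; split; [apply lt_S_r; exact (incr_below_length _ _ _ Hs)|].
      split; [exact H0|split; [exact H1|]].
      exists s; split; [exact (incr_below_bound _ _ _ Hs)|auto].
    + intros (l & _ & H0 & H1 & s & _ & Hs & H2 & H3); exists l, s; auto.
  - solve_CDef.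
Qed.

#[global] Hint Resolve CDef_hit : cdef.

Lemma CDef_bad r k n m c : CFun r -> CFun k -> CFun n -> CFun m -> CFun c ->
  CDef (fun M x => bad (r M x) (k M x) (n M x) (m M x) (c M x)).
Proof.
  intros Hr Hk Hn Hm Hc; unfold bad, isq; solve_CDef.
Qed.

#[global] Hint Resolve CDef_bad : cdef.

Lemma Dec_CDef (M : structure) (HM : is_model M) (P : forall M : structure, M -> Prop) (p : M) :
  CDef P -> Dec (fun x => P M (pair p x)).
Proof.
  intros [c H].
  replace (fun x => P M (pair p x)) with (fun x => cst c (pair p x) = zero).
  - solve_Dec.
  - extensionality x; apply propositional_extensionality; symmetry; now apply H.
Qed.

(** A case distinction: the value at (m, d) is m if d = 0, and 0 otherwise. *)
Definition CIfz : const := CRec CId CZero.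

Section Combinatorics.

Context {M : structure} {HM : is_model M}.
Implicit Types c d s t u v w x y z k l m n r i j p : M.

Lemma bad_least r k n m c : bad r k n m c -> exists d, le d c /\ least_bad r k n m d.
Proof.
  intros Hc; apply NNPP; intros Hno.
  (* The model may be nonstandard, so a least element exists only for predicates open to [m_ind].
     Packing the parameters into one number makes this one [CDef] and hence [Dec]. *)
  pose (P := fun (N : structure) (x : N) =>
    let q := cst CK x in forall d : N, lt d (succ (cst CL x)) ->
      ~ bad (cst CK (cst CK (cst CK q))) (cst CL (cst CK (cst CK q)))
            (cst CL (cst CK q)) (cst CL q) d).
  assert (HP : CDef P).
  { unfold P; cbv zeta; solve_CDef. }
  assert (E : forall x, P M (pair (pair (pair (pair r k) n) m) x) <->
    forall d, lt d (succ x) -> ~ bad r k n m d).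
  { intros x; unfold P. repeat rewrite ?(m_K _ HM), ?(m_L _ HM). reflexivity. }
  assert (K : forall x, le x c -> P M (pair (pair (pair (pair r k) n) m) x)).
  { refine (m_ind _ _ (fun x => le x c -> P M (pair (pair (pair (pair r k) n) m) x)) _ _ _).
    - apply (Dec_imp (fun x => le x c)); [solve_Dec|now apply Dec_CDef].
    - intros _; apply E. intros d Hd Hb. apply Hno; exists d.
      apply (proj1 (lt_S_r _ _)) in Hd. split; [exact (le_trans _ _ _ Hd (le_0_l _))|].
      split; [exact Hb|]. intros e He _.
      exact (not_lt_0 _ (lt_le_trans _ _ _ He Hd)).
    - intros x IH Hx. specialize (IH (lt_le _ _ Hx)). apply E. 
      pose proof (proj1 (E x) IH) as IH'.
      intros d Hd. apply lt_S_cases in Hd as [Hd| ->]; [now apply IH'|].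
      intros Hb; apply Hno; exists (succ x); split; [exact Hx|split; [exact Hb|exact IH']]. }
  apply (proj1 (E c) (K c (le_refl _)) c (lt_S _) Hc).
Qed.

Lemma least_bad_unique r k n m c d :
  least_bad r k n m c -> least_bad r k n m d -> c = d.
Proof.
  intros [Hc Lc] [Hd Ld]; destruct (lt_trichotomy c d) as [H|[H|H]]; auto.
  - now apply Ld in H.
  - now apply Lc in H.
Qed.

Lemma bad_colour r k n m c i : bad r k n m c -> lt (ent c i) (succ r).
Proof.
  intros (Hc & H & _). destruct (le_or_lt (len c) i) as [K|K]; [|now apply H].
  rewrite ent_beyond by assumption. apply lt_S_r, le_0_l.
Qed.

(** Only the entries at k-tuples below m matter, and these tuples are coded below [seq_bound m k].
    Cutting or padding to that length preserves badness and bounds the code, so that goodness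
    becomes a bounded statement. *)
Lemma bad_bounded r k n m c : bad r k n m c ->
  exists d, lt d (seq_bound (succ r) (seq_bound m k)) /\ bad r k n m d.
Proof.
  intros Hb; destruct (seq_of_fun (fun i => ent c i) (seq_bound m k)) as (d & Qd & Ld & Ed);
    [unfold ent; solve_Fn|].
  assert (Bd : forall i, lt i (len d) -> lt (ent d i) (succ r)).
  { intros i Hi; rewrite Ld in Hi; rewrite Ed by exact Hi. exact (bad_colour _ _ _ _ _ _ Hb). }
  exists d; split; [|split; [exact Qd|split; [exact Bd|]]].
  - apply lt_seq_bound; auto. intros i Hi; rewrite <- Ld in Hi; apply lt_le; auto.
  - intros (l & s & H0 & Hs & H1 & H2 & H3). apply (proj2 (proj2 Hb)).
    exists l, s; repeat (split; [assumption|]).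
    intros u v Hu Hv; destruct (H3 u v Hu Hv) as (x & y & Hx & Hy & E).
    exists x, y; repeat (split; [assumption|]).
    rewrite !Ed in E; [exact E| |]; eapply incr_below_bound, composite_incr_below; eassumption.
Qed.

Lemma good_zero_lt r k n m : good r k n m -> lt zero m.
Proof.
  (* The code 0 is the empty colouring. It would be bad for m = 0, because no sequence lies below
     0. *)
  intros H; apply NNPP; intros Hm; apply (H zero).
  assert (L0 : len (zero : M) = zero) by apply K_0.
  split; [|split].
  - unfold isq; rewrite iterL_S, L0, iterL_0; apply L_0.
  - rewrite L0; intros i Hi; now apply not_lt_0 in Hi.
  - intros (l & s & _ & Hs & _); apply Hm. exact (incr_below_pos _ _ _ Hs).
Qed.

Lemma good_or_least_bad r k n m : good r k n m \/ exists c, least_bad r k n m c.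
Proof.
  destruct (classic (good r k n m)) as [H|H]; [now left|right].
  apply not_all_not_ex in H as [c Hc]; apply bad_least in Hc as (d & _ & Hd). now exists d.
Qed.

Lemma above_zero r k n x : above r k n zero x.
Proof.
  destruct (good_or_least_bad r k n (ent x k)) as [H|[c Hc]]; [now left|right].
  destruct (restr_exists x k) as [y Hy].
  exists c; split; [exact Hc|]. exists y; split; [exact Hy|apply le_0_l].
Qed.

(** Both hypotheses speak of the same colour: the least bad colouring is unique, and so is the
    initial segment. Excluding equality then raises the lower bound by one. *)
Lemma above_succ r k n i x :
  above r k n i x -> differs r k n i x -> above r k n (succ i) x.
Proof.
  intros [H|(c & Hc & y & Hy & Hi)]; [now left|].
  intros [H|(d & Hd & z & Hz & Hj)]; [now left|]. right.
  rewrite (least_bad_unique _ _ _ _ _ _ Hd Hc), (restr_unique _ _ _ _ Hz Hy) in Hj.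
  exists c; split; [exact Hc|]; exists y; split; [exact Hy|].
  apply le_cases in Hi as [Hi|Hi]; [exact Hi|congruence].
Qed.

Lemma above_all r k n x : above r k n (succ r) x -> good r k n (ent x k).
Proof.
  intros [H|(c & [Hc _] & y & _ & Hi)]; [exact H|].
  destruct (le_not_lt _ _ Hi). exact (bad_colour _ _ _ _ _ _ Hc).
Qed.

Definition fcomposite x (ζ : M -> M) s : Prop := isq x /\ len x = len s /\
  forall i, lt i (len s) -> ent x i = ζ (ent s i).

Lemma fcomposite_exists ζ s : Fn ζ -> exists x, fcomposite x ζ s.
Proof.
  intros Hζ; destruct (seq_of_fun (fun i => ζ (ent s i)) (len s)) as (x & H);
    [unfold ent; solve_Fn|]. now exists x.
Qed.

Lemma incr_below_append u l k : incr_below u l k -> exists s,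
  incr s (succ k) /\ ent s k = l /\ forall j, lt j k -> ent s j = ent u j.
Proof.
  intros Hu; pose proof (incr_below_entries _ _ _ Hu) as Bu.
  destruct Hu as [(Qu & Lu & Iu) _].
  (* For j < k the second summand is 0; at j = k it is l, while u contributes its default entry
     0. *)
  destruct (seq_of_fun (fun j => add (ent u j) (cst CIfz (pair l (sub k j)))) (succ k))
    as (s & Qs & Ls & Es); [unfold ent; unfold_terms; solve_Fn|].
  assert (Ek : ent s k = l).
  { rewrite Es by apply lt_S. rewrite ent_beyond, sub_diag, add_0_l;
      [|exact Qu|rewrite Lu; apply le_refl].
    unfold CIfz; rewrite (m_rec0 _ HM); apply (m_id _ HM). }
  assert (Ej : forall j, lt j k -> ent s j = ent u j).
  { intros j Hj. rewrite Es by now apply lt_S_r, lt_le.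
    rewrite (sub_pos _ _ Hj). unfold CIfz; rewrite (m_recS _ HM), (m_zero _ HM); apply add_0_r. }
  exists s; split; [split; [exact Qs|split; [exact Ls|]]|auto].
  intros j i Hji Hi; apply lt_S_cases in Hi as [Hi| ->].
  - rewrite (Ej i Hi), (Ej j (lt_trans _ _ _ Hji Hi)); now apply Iu.
  - rewrite Ek, (Ej j Hji); now apply Bu.
Qed.

Lemma initial_segment k l : le k l -> lt zero l -> exists u, incr_below u l k.
Proof.
  intros Hk Hl. destruct (seq_of_fun (fun j => j) k) as (u & Qu & Lu & Eu); [solve_Fn|].
  exists u; split; [split; [exact Qu|split; [exact Lu|]]|].
  - intros j i Hji Hi; rewrite (Eu i Hi), (Eu j (lt_trans _ _ _ Hji Hi)); exact Hji.
  - destruct (zero_or_succ k) as [->|E].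
    + rewrite ent_beyond; [exact Hl|exact Qu|rewrite Lu; apply le_0_l].
    + assert (H : lt (pred k) k) by (rewrite E at 2; apply lt_S).
      rewrite Eu by exact H. exact (lt_le_trans _ _ _ H Hk).
Qed.

Lemma append_along ζ w l k : Fn ζ -> incr_below w l k -> exists s x,
  incr s (succ k) /\ fcomposite x ζ s /\ ent x k = ζ l /\
  forall j, lt j k -> ent x j = ζ (ent w j).
Proof.
  intros Hζ Hw; destruct (incr_below_append w l k Hw) as (s & Hs & Ek & Ej).
  destruct (fcomposite_exists ζ s Hζ) as (x & Hx). exists s, x.
  pose proof Hx as (_ & _ & Ex); destruct Hs as (Qs & Ls & Is); rewrite Ls in Ex.
  split; [now split|split; [exact Hx|split]].
  - rewrite Ex by apply lt_S. now rewrite Ek.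
  - intros j Hj; rewrite Ex by now apply lt_S_r, lt_le. now rewrite Ej.
Qed.

Lemma above_zero_almost_full ζ r k n : Fn ζ ->
  exists s, incr s (succ k) /\ exists x, fcomposite x ζ s /\ above r k n zero x.
Proof.
  intros Hζ; destruct (initial_segment k (succ k)) as [u Hu];
    [apply lt_le, lt_S|apply lt_S_r, le_0_l|].
  destruct (append_along ζ u _ k Hζ Hu) as (s & x & Hs & Hx & _).
  exists s; split; [exact Hs|]; exists x; split; [exact Hx|apply above_zero].
Qed.

(* For increasing ζ and l large, ζ(0), ..., ζ(l - 1) is a relatively large set below m = ζ(l). If m is not good, this set is not homogeneous for the least bad colouring, so some k-tuple from it gets a colour other than i; append l to its indices. *)
Lemma differs_almost_full ζ r k n i : Fn ζ ->
  (forall i j, lt i j -> lt (ζ i) (ζ j)) ->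
  exists s, incr s (succ k) /\ exists x, fcomposite x ζ s /\ differs r k n i x.
Proof.
  (* The bounds n ≤ l and ζ(0) ≤ l make the set relatively large, and k ≤ l provides a k-tuple below
     l for the case that ζ(l) is good. *)
  intros Hζ Iζ. set (l := succ (add (add n (ζ zero)) k)).
  assert (l0 : lt zero l) by (apply lt_S_r, le_0_l).
  assert (lk : le k l) by (apply lt_le, lt_S_r, le_add_r).
  assert (ln : le n l).
  { apply lt_le, lt_S_r. exact (le_trans _ _ _ (le_add_l _ _) (le_add_l _ _)). }
  assert (lz : le (ζ zero) l).
  { apply lt_le, lt_S_r. exact (le_trans _ _ _ (le_add_r _ _) (le_add_l _ _)). }
  destruct (good_or_least_bad r k n (ζ l)) as [Hg|[c Hc]].
  - destruct (initial_segment k l lk l0) as [u Hu].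
    destruct (append_along ζ u l k Hζ Hu) as (s & x & Hs & Hx & Ex & _).
    exists s; split; [exact Hs|]; exists x; split; [exact Hx|left]. now rewrite Ex.
  - destruct (seq_of_fun ζ l Hζ) as (S & QS & LS & ES).
    assert (HS : incr_below S (ζ l) l).
    { split; [split; [exact QS|split; [exact LS|]]|].
      - intros j h Hjh Hh; rewrite (ES h Hh), (ES j (lt_trans _ _ _ Hjh Hh)); auto.
      - assert (H : lt (pred l) l) by (unfold l; rewrite pred_S; apply lt_S).
        rewrite ES by exact H; auto. }
    assert (Hw : exists w z, incr_below w l k /\ composite z S w /\ ent c z <> i).
    { apply NNPP; intros Hno. apply (proj2 (proj2 (proj1 Hc))).
      exists l, S; repeat (split; [assumption|]). split; [now rewrite (ES _ l0)|].
      assert (K : forall w z, incr_below w l k -> composite z S w -> ent c z = i).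
      { intros w z H1 H2; apply NNPP; intros H3; apply Hno; now exists w, z. }
      intros u v Hu Hv; destruct (composite_exists S u) as [x Hx],
        (composite_exists S v) as [y Hy].
      exists x, y; split; [exact Hx|split; [exact Hy|]].
      now rewrite (K u x), (K v y). }
    destruct Hw as (w & z & Hw & (Qz & Lz & Ez) & Hi).
    destruct (append_along ζ w l k Hζ Hw) as (s & x & Hs & Hx & Ek & Ej).
    exists s; split; [exact Hs|]; exists x; split; [exact Hx|right].
    rewrite Ek; exists c; split; [exact Hc|]; exists z; split; [|exact Hi].
    pose proof (incr_below_entries _ _ _ Hw) as Bw.
    destruct Hw as [(Qw & Lw & _) _]; rewrite Lw in *.
    split; [exact Qz|split; [exact Lz|]]. intros j Hj.
    rewrite Ez, Ej, ES; auto.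
Qed.

End Combinatorics.

(** * Constants for goodness and for the sets of tuples *)

Lemma CDef_good r k n m : CFun r -> CFun k -> CFun n -> CFun m ->
  CDef (fun M x => good (r M x) (k M x) (n M x) (m M x)).
Proof.
  intros Hr Hk Hn Hm. apply (CDef_ext _ (fun M x =>
    forall c, lt c (seq_bound (succ (r M x)) (seq_bound (m M x) (k M x))) ->
      ~ bad (r M x) (k M x) (n M x) (m M x) c)).
  - intros M HM x; split; [intros H c _; apply H|].
    intros H c Hc; apply bad_bounded in Hc as (d & Hd & Bd). exact (H d Hd Bd).
  - solve_CDef.
Qed.

Lemma CDef_least_bad r k n m c : CFun r -> CFun k -> CFun n -> CFun m -> CFun c ->
  CDef (fun M x => least_bad (r M x) (k M x) (n M x) (m M x) (c M x)).
Proof.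
  intros Hr Hk Hn Hm Hc; unfold least_bad; solve_CDef.
Qed.

Lemma least_bad_bound {M : structure} {HM : is_model M} (r k n m c : M) :
  least_bad r k n m c -> lt c (seq_bound (succ r) (seq_bound m k)).
Proof.
  intros [Hc H]; destruct (bad_bounded _ _ _ _ _ Hc) as (d & Hd & Bd).
  destruct (le_or_lt c d) as [K|K]; [exact (le_lt_trans _ _ _ K Hd)|].
  destruct (H d K Bd).
Qed.

#[global] Hint Resolve CDef_good CDef_least_bad : cdef.

Lemma CDef_above r k n i x : CFun r -> CFun k -> CFun n -> CFun i -> CFun x ->
  CDef (fun M z => above (r M z) (k M z) (n M z) (i M z) (x M z)).
Proof.
  intros Hr Hk Hn Hi Hx. apply (CDef_ext _ (fun M z =>
    good (r M z) (k M z) (n M z) (ent (x M z) (k M z)) \/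
    exists c, lt c (seq_bound (succ (r M z)) (seq_bound (ent (x M z) (k M z)) (k M z))) /\
      least_bad (r M z) (k M z) (n M z) (ent (x M z) (k M z)) c /\
      exists y, lt y (seq_bound (x M z) (k M z)) /\
        restr y (x M z) (k M z) /\ le (i M z) (ent c y))).
  - intros M HM z; split; (intros [H|H]; [now left|right]).
    + destruct H as (c & Hc & y & Hy & E).
      exists c; split; [now apply least_bad_bound with (n M z)|split; [exact Hc|]].
      exists y; split; [now apply restr_bound|auto].
    + destruct H as (c & _ & Hc & y & _ & Hy & E). exists c; split; [exact Hc|now exists y].
  - solve_CDef.
Qed.

Lemma CDef_differs r k n i x : CFun r -> CFun k -> CFun n -> CFun i -> CFun x ->
  CDef (fun M z => differs (r M z) (k M z) (n M z) (i M z) (x M z)).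
Proof.
  intros Hr Hk Hn Hi Hx. apply (CDef_ext _ (fun M z =>
    good (r M z) (k M z) (n M z) (ent (x M z) (k M z)) \/
    exists c, lt c (seq_bound (succ (r M z)) (seq_bound (ent (x M z) (k M z)) (k M z))) /\
      least_bad (r M z) (k M z) (n M z) (ent (x M z) (k M z)) c /\
      exists y, lt y (seq_bound (x M z) (k M z)) /\
        restr y (x M z) (k M z) /\ ~ (ent c y = i M z))).
  - intros M HM z; split; (intros [H|H]; [now left|right]).
    + destruct H as (c & Hc & y & Hy & E).
      exists c; split; [now apply least_bad_bound with (n M z)|split; [exact Hc|]].
      exists y; split; [now apply restr_bound|auto].
    + destruct H as (c & _ & Hc & y & _ & Hy & E). exists c; split; [exact Hc|now exists y].
  - solve_CDef.
Qed.

(** * Bounded quantifiers in the theory *)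

Lemma true_prv_fle t u : true_prv (t ≼ u).
Proof. unfold fle; auto with truth nocore. Qed.

Lemma prv_true_fle t u : prv_true (t ≼ u).
Proof. unfold fle; auto with truth nocore. Qed.

Lemma true_prv_flt t u : true_prv (t ≺ u).
Proof. apply true_prv_fle. Qed.

Lemma prv_true_flt t u : prv_true (t ≺ u).
Proof. apply prv_true_fle. Qed.

#[global] Hint Resolve true_prv_fle prv_true_fle true_prv_flt prv_true_flt : truth.

Lemma teval_tlift0 {M : structure} (φ : nat -> M) ψ x t :
  teval (scons x φ) ψ (tlift0 t) = teval φ ψ t.
Proof.
  unfold tlift0; induction t as [i| |F t IH|t IHt u IHu]; cbn [tsubst teval]; auto.
  - now rewrite fsubst_id, IH.
  - now rewrite IHt, IHu.
Qed.

Lemma holds_fle {M : structure} (φ : nat -> M) ψ t u :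
  holds φ ψ (t ≼ u) <-> le (teval φ ψ t) (teval φ ψ u).
Proof.
  unfold le, fle; cbn [holds]; split; intros [z Hz]; exists z;
    (rewrite <- (teval_tlift0 φ ψ z t), <- (teval_tlift0 φ ψ z u) ||
     rewrite <- (teval_tlift0 φ ψ z t), <- (teval_tlift0 φ ψ z u) in Hz); exact Hz.
Qed.

Lemma holds_flt {M : structure} (φ : nat -> M) ψ t u :
  holds φ ψ (t ≺ u) <-> lt (teval φ ψ t) (teval φ ψ u).
Proof. exact (holds_fle φ ψ (Succ t) u). Qed.

Lemma prv_lt_0 Γ t : (Γ ⊢ t ≺ Zero) -> Γ ⊢ Bot.
Proof.
  intros H; apply (cut _ _ _ H), (weakening _ [t ≺ Zero]); [|intros ? [<-|[]]; apply in_eq].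
  apply by_models; [intros ? [<-|[]]; auto with truth nocore|auto with truth nocore|].
  intros M HM φ ψ _ K. specialize (K _ (in_eq _ _)). apply holds_flt in K.
  exact (not_lt_0 _ K).
Qed.

Lemma prv_lt_succ_cases Γ t u : (Γ ⊢ t ≺ Succ u) -> Γ ⊢ t ≺ u ⊔ u ≐ t.
Proof.
  intros H; apply (cut _ _ _ H), (weakening _ [t ≺ Succ u]); [|intros ? [<-|[]]; apply in_eq].
  apply by_models; [intros ? [<-|[]]; auto with truth nocore|auto with truth nocore|].
  intros M HM φ ψ _ K. specialize (K _ (in_eq _ _)). apply holds_flt in K.
  apply lt_S_cases in K as [K|K]; [left; now apply holds_flt|right; symmetry; exact K].
Qed.

Lemma prv_lt_succ Γ t u : (Γ ⊢ t ≺ u) -> Γ ⊢ t ≺ Succ u.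
Proof.
  intros H; apply (cut _ _ _ H), (weakening _ [t ≺ u]); [|intros ? [<-|[]]; apply in_eq].
  apply by_models; [intros ? [<-|[]]; auto with truth nocore|auto with truth nocore|].
  intros M HM φ ψ _ K. specialize (K _ (in_eq _ _)). apply holds_flt in K.
  apply holds_flt. exact (lt_trans _ _ _ K (lt_S _)).
Qed.

Lemma prv_lt_succ_diag Γ t : Γ ⊢ t ≺ Succ t.
Proof.
  apply closed_weakening, by_models; [intros ? []|auto with truth nocore|].
  intros M HM φ ψ _ _. apply holds_flt, lt_S.
Qed.

Ltac subst_eq :=
  unfold lift0, inst0; rewrite ?subst_comp; f_equal;
  let i := fresh "i" in extensionality i; destruct i; reflexivity.

(** Bounded search inside the theory. In a saturated set the second disjunct has a witness, which
    would make the bounded universal formula false in the model; this is how such formulas pass from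
    truth to provability. *)
Lemma prv_bounded_or A : (forall Γ, Γ ⊢ A ⊔ Not A) -> forall Γ t,
  Γ ⊢ (∀₀ #0 ≺ tlift0 t ⇒ A) ⊔ (∃₀ #0 ≺ tlift0 t ⊓ Not A).
Proof.
  intros dec Γ t.
  (* In [A'] the index 1 is left free for the bound, over which the induction runs. *)
  pose (A' := subst (scons #0 (fun i => #(S (S i)))) FVar A).
  assert (H : [] ⊢ ∀₀ (∀₀ #0 ≺ #1 ⇒ A') ⊔ (∃₀ #0 ≺ #1 ⊓ Not A')).
  { apply prv_ind.
    - apply prv_orI1, prv_all0I, prv_impI, prv_botE, (prv_lt_0 _ #0); hyp.
    - unfold Not; cbn [subst].
      set (AS := subst _ _ A').
      assert (EA : AS = A').
      { unfold AS, A'; subst_eq. }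
      rewrite EA.
      change (((∀₀ #0 ≺ #1 ⇒ A') ⊔ (∃₀ #0 ≺ #1 ⊓ Not A')) :: [] ⊢
        (∀₀ #0 ≺ Succ #1 ⇒ A') ⊔ (∃₀ #0 ≺ Succ #1 ⊓ Not A')).
      apply prv_orE with (∀₀ #0 ≺ #1 ⇒ A') (∃₀ #0 ≺ #1 ⊓ Not A'); [hyp| |].
      + apply prv_orE with A (Not A); [apply dec| |].
        * apply prv_orI1, prv_all0I, prv_impI.
          apply prv_orE with (#0 ≺ #1) (#1 ≐ #0); [apply prv_lt_succ_cases; hyp| |].
          -- apply (prv_impE _ _ (#0 ≺ #1)); [|hyp].
             apply (prv_instE0 _ (#0 ≺ #2 ⇒ subst (up0 (fun i => #(S i))) FVar A') #0); [hyp|].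
             cbn [inst0 subst]; unfold inst0; cbn [subst]; f_equal.
             unfold A'; subst_eq.
          -- apply (prv_rewrite _ (subst (scons #0 (fun i => #(S (S (S i))))) FVar A) #1 #0 (lift0 A));
               [hyp|subst_eq|unfold A'; subst_eq|hyp].
        * apply prv_orI2, (prv_ex0I _ _ _ #0).
          apply prv_andI; [apply (prv_lt_succ_diag _ #0)|].
          assert (E : inst0 #0 A' = A).
          { unfold A', inst0. rewrite subst_comp. rewrite <- (subst_id A) at 2; f_equal.
            extensionality i; destruct i; reflexivity. }
          refine (_ : _ ⊢ Not (inst0 #0 A')). rewrite E; hyp.
      + apply prv_orI2. apply (prv_ex0E _ _ (#0 ≺ #1 ⊓ Not A')); [hyp|].
        apply (prv_ex0I _ _ _ #0). apply prv_andI.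
        * apply (prv_lt_succ _ #0 #1), (prv_andE1 _ _ _ (Not A')); hyp.
        * assert (E : inst0 #0 (subst (up0 (fun i => #(S i))) FVar A') = A')
            by (unfold A'; subst_eq).
          refine (_ : _ ⊢ Not (inst0 #0 (subst (up0 (fun i => #(S i))) FVar A'))).
          rewrite E. apply (prv_andE2 _ _ (#0 ≺ #1)); hyp. }
  apply (prv_instE0 _ _ t _ (closed_weakening _ _ H)).
  assert (E : subst (up0 (scons t Var)) FVar A' = A).
  { unfold A'. rewrite subst_comp. rewrite <- (subst_id A) at 2. f_equal.
    extensionality i; destruct i; reflexivity. }
  rewrite <- E at 1 2; reflexivity.
Qed.

Lemma true_prv_bounded A t : (forall Γ, Γ ⊢ A ⊔ Not A) -> true_prv A ->
  true_prv (∀₀ #0 ≺ tlift0 t ⇒ A).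
Proof.
  intros dec HA Δ HΔ σ τ H.
  pose proof (prv_subst _ _ _ theory_subst_closed (prv_bounded_or A dec [] t) σ τ) as K.
  apply (sat_nil _ HΔ), (sat_or _ HΔ) in K as [K|K]; [exact K|exfalso].
  assert (KT : prv_true (∃₀ #0 ≺ tlift0 t ⊓ Not A))
    by (unfold Not; auto with truth nocore).
  destruct (KT Δ HΔ σ τ K) as (x & Hx & Hn). exact (Hn (H x Hx)).
Qed.

Ltac members := let B := fresh "B" in intros B HB; cbn [In] in HB;
  repeat (destruct HB as [<-|HB]); try contradiction.

Ltac classify := auto 100 with truth nocore.

(** The context may contain formulas, such as [almost_full], for which provability is not known to
    imply truth. The models then work from suitable consequences of the context. *)
Lemma by_models_from Γ Γ' A :
  (forall B, In B Γ' -> Γ ⊢ B) -> (forall B, In B Γ' -> prv_true B) -> true_prv A ->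
  (forall M : structure, is_model M -> forall (φ : nat -> M) ψ, assignment ψ ->
     (forall B, In B Γ' -> holds φ ψ B) -> holds φ ψ A) ->
  Γ ⊢ A.
Proof.
  intros HΓ T1 T2 H; pose proof (by_models Γ' A T1 T2 H) as K. clear T1 T2 H.
  revert A K; induction Γ' as [|B Γ' IH]; intros A K; [now apply closed_weakening|].
  apply (prv_impE _ _ B); [|apply HΓ, in_eq].
  apply IH; [intros; apply HΓ; now right|]. now apply prv_impI.
Qed.

(** * Transfer for the notions about sequences *)

Lemma true_prv_seq_comp x t s : true_prv (seq_comp x t s).
Proof.
  unfold seq_comp, is_seq; apply true_prv_and; [|apply true_prv_and]; classify.
  apply (true_prv_bounded _ (tlength s)); classify. intros; apply prv_eq_dec.
Qed.

Lemma true_prv_fun_comp x F s : true_prv (fun_comp x F s).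
Proof.
  unfold fun_comp, is_seq; apply true_prv_and; [|apply true_prv_and]; classify.
  apply (true_prv_bounded _ (tlength s)); classify. intros; apply prv_eq_dec.
Qed.

Lemma prv_true_fun_comp x F s : prv_true (fun_comp x F s).
Proof. unfold fun_comp, is_seq; classify. Qed.

Lemma holds_incr_seq {M : structure} (φ : nat -> M) ψ s k :
  holds φ ψ (incr_seq s k) -> incr (teval φ ψ s) (teval φ ψ k).
Proof.
  intros (H1 & H2 & H3); split; [exact H1|split; [exact H2|]].
  intros j i Hji Hi. specialize (H3 j i).
  cbn [holds] in H3; rewrite !holds_flt in H3.
  cbn [teval tentry] in H3; rewrite !teval_tlift0 in H3. now apply H3.
Qed.

Lemma prv_true_incr_seq s k : prv_true (incr_seq s k).
Proof. unfold incr_seq, is_seq; classify. Qed.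

(** The outer quantifier of [incr_seq] carries no explicit bound, so [true_prv_bounded] does not
    fit. An equation with a constant stands in: it is true with [incr_seq], being an equation it is
    then provable, and [incr_seq] is derivable from it. *)
Lemma true_prv_incr_seq s k : true_prv (incr_seq s k).
Proof.
  destruct (CDef_incr (fun M z => cst CK z) (fun M z => cst CL z)) as [c Hc];
    [solve_CFun|solve_CFun|].
  assert (Hc' : forall M, is_model M -> forall s k : M,
    incr s k <-> cst c (pair s k) = zero).
  { intros M HM s' k'. rewrite <- Hc by assumption. now rewrite (m_K _ HM), (m_L _ HM). }
  assert (H : [] ⊢ ∀₀ ∀₀ FConst c @ J #1 #0 ≐ Zero ⇒ incr_seq #1 #0).
  { apply prv_all0I, prv_all0I, prv_impI.
    apply prv_andI; [|apply prv_andI].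
    - apply by_models; [members; classify|unfold is_seq; classify|].
      intros M HM φ ψ _ H; specialize (H _ (in_eq _ _)).
      apply (Hc' M HM) in H; apply H.
    - apply by_models; [members; classify|classify|].
      intros M HM φ ψ _ H; specialize (H _ (in_eq _ _)).
      apply (Hc' M HM) in H; apply H.
    - apply prv_all0I, prv_all0I, prv_impI, prv_impI.
      apply (by_models [#0 ≺ #2; #1 ≺ #0; FConst c @ J #3 #2 ≐ Zero]
        (tentry #3 #1 ≺ tentry #3 #0)); [members; classify|classify|].
      intros M HM φ ψ _ H.
      pose proof (H _ (or_introl eq_refl)) as H1.
      pose proof (H _ (or_intror (or_introl eq_refl))) as H2.
      pose proof (H _ (or_intror (or_intror (or_introl eq_refl)))) as H3.
      apply (Hc' M HM) in H3. exact (proj2 (proj2 H3) _ _ H2 H1). }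
  intros Δ HΔ σ τ K.
  pose proof (prv_instE00 _ _ s k _ H eq_refl) as E.
  apply (prv_subst _ _ _ theory_subst_closed) with (σ := σ) (τ := τ) in E.
  apply (sat_nil _ HΔ) in E. apply (sat_mp _ HΔ _ _ E).
  apply (true_prv_eq (FConst c @ J s k) Zero Δ HΔ σ τ).
  apply (Hc' _ (canonical_model Δ HΔ)). exact (holds_incr_seq _ _ s k K).
Qed.

#[global] Hint Resolve true_prv_seq_comp true_prv_fun_comp prv_true_fun_comp
  prv_true_incr_seq true_prv_incr_seq : truth.

Lemma true_prv_incr_seq_below s m k : true_prv (incr_seq_below s m k).
Proof. unfold incr_seq_below; classify. Qed.

Lemma prv_true_incr_seq_below s m k : prv_true (incr_seq_below s m k).
Proof. unfold incr_seq_below; classify. Qed.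

#[global] Hint Resolve true_prv_incr_seq_below prv_true_incr_seq_below : truth.

Lemma prv_true_colouring c m k r : prv_true (colouring c m k r).
Proof. unfold colouring, is_seq; classify. Qed.

Lemma prv_true_incr_fun F : prv_true (incr_fun F).
Proof. unfold incr_fun; classify. Qed.

#[global] Hint Resolve prv_true_colouring prv_true_incr_fun : truth.

(** IRT needs functions of the tuple alone, whereas the constants also take r, k, n and i. Fixing
    these parameters combines a constant function, pairing with the identity, and composition. *)
Lemma prv_section c Γ : Γ ⊢ ∀₀ ∃₁ ∀₀ $0 @ #0 ≐ FConst c @ J #1 #0.
Proof.
  apply closed_weakening, prv_all0I.
  apply (prv_ex1E _ _ (∀₀ $0 @ #0 ≐ #1)).
  { exact (prv_instE0 _ _ #0 _ (prv_constant_function []) eq_refl). }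
  apply (prv_ex1E _ _ (∀₀ $0 @ #0 ≐ J ($1 @ #0) (FConst CId @ #0))).
  { exact (prv_instE1 _ _ (FConst CId) _
      (prv_instE1 _ _ $0 _ (prv_BIM _ _ bim_cl_pair) eq_refl) eq_refl). }
  apply (prv_ex1E _ _ (∀₀ $0 @ #0 ≐ FConst c @ ($1 @ #0))).
  { exact (prv_instE1 _ _ $0 _
      (prv_instE1 _ _ (FConst c) _ (prv_BIM _ _ bim_cl_comp) eq_refl) eq_refl). }
  apply (prv_ex1I _ _ _ $0), prv_all0I.
  apply (by_models [∀₀ $0 @ #0 ≐ FConst c @ ($1 @ #0);
    ∀₀ $1 @ #0 ≐ J ($2 @ #0) (FConst CId @ #0); ∀₀ $2 @ #0 ≐ #2]
    ($0 @ #0 ≐ FConst c @ J #1 #0)); [members; classify|classify|].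
  intros M HM φ ψ _ H.
  pose proof (H _ (or_introl eq_refl) (φ 0)) as H1.
  pose proof (H _ (or_intror (or_introl eq_refl)) (φ 0)) as H2.
  pose proof (H _ (or_intror (or_intror (or_introl eq_refl))) (φ 0)) as H3.
  cbn in H1, H2, H3 |- *. now rewrite H1, H2, H3, (m_id _ HM).
Qed.

(** * The derivation *)

(** The constants put here vanish exactly off their sets, as in [represents_above]. The formula
    therefore places x inside the set, in the shape required by [D]; what x avoids is the zero set
    of c. *)
Definition not_in (c : const) (r k n i x : tm) : form :=
  Not (FConst c @ J (J (J (J r k) n) i) x ≐ Zero).

(** The matrix of [almost_full] for one function. Being existential, it passes between truth and
    provability in both directions whenever A does. *)
Definition some_tuple (k : tm) (F : fn) (A : form) : form :=
  ∃₀ incr_seq #0 k ⊓ (∃₀ fun_comp #0 F #1 ⊓ A).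

Lemma prv_true_some_tuple k F A : prv_true A -> prv_true (some_tuple k F A).
Proof. intros H; unfold some_tuple; classify. Qed.

Lemma true_prv_some_tuple k F A : true_prv A -> true_prv (some_tuple k F A).
Proof. intros H; unfold some_tuple; classify. Qed.

Lemma true_prv_not_in c r k n i x : true_prv (not_in c r k n i x).
Proof. unfold not_in, Not; classify. Qed.

Lemma prv_true_not_in c r k n i x : prv_true (not_in c r k n i x).
Proof. unfold not_in, Not; classify. Qed.

Lemma true_prv_D F : true_prv (D F).
Proof. unfold D, Not; classify. Qed.

Lemma prv_true_D F : prv_true (D F).
Proof. unfold D, Not; classify. Qed.

#[global] Hint Resolve prv_true_some_tuple true_prv_some_tuple true_prv_not_in
  prv_true_not_in true_prv_D prv_true_D : truth.

Lemma prv_IRT_succ Γ k A : inst0 (Succ k) (IRT #0) = A -> Γ ⊢ A.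
Proof.
  intros <-. apply (prv_impE _ _ (Succ Zero ≼ Succ k)).
  - refine (prv_instE0 _ (Succ Zero ≼ #0 ⇒ IRT #0) (Succ k) _ _ eq_refl).
    apply prv_axiom; right; reflexivity.
  - apply closed_weakening, by_models; [members|classify|].
    intros M HM φ ψ _ _; apply holds_fle, le_S_S, le_0_l.
Qed.

Lemma prv_incr_id Γ : Γ ⊢ incr_fun (FConst CId).
Proof.
  apply prv_all0I, prv_all0I, prv_impI.
  apply (by_models_from _ [#1 ≺ #0] (FConst CId @ #1 ≺ FConst CId @ #0));
    [members; hyp|members; classify|classify|].
  intros M HM φ ψ _ H; specialize (H _ (in_eq _ _)).
  apply holds_flt in H; apply holds_flt; cbn in *. now rewrite !(m_id _ HM).
Qed.

Definition represents_above (c : const) : Prop :=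
  forall M : structure, is_model M -> forall r k n i x : M,
  cst c (pair (pair (pair (pair r k) n) i) x) = zero <-> ~ above r k n i x.

Definition represents_differs (c : const) : Prop :=
  forall M : structure, is_model M -> forall r k n i x : M,
  cst c (pair (pair (pair (pair r k) n) i) x) = zero <-> ~ differs r k n i x.

Lemma represents_above_exists : exists c, represents_above c.
Proof.
  destruct (CDef_not _ (CDef_above (fun M z => cst CK (cst CK (cst CK (cst CK z))))
    (fun M z => cst CL (cst CK (cst CK (cst CK z)))) (fun M z => cst CL (cst CK (cst CK z)))
    (fun M z => cst CL (cst CK z)) (fun M z => cst CL z)
    ltac:(solve_CFun) ltac:(solve_CFun) ltac:(solve_CFun) ltac:(solve_CFun) ltac:(solve_CFun)))
    as [c Hc].
  exists c; intros M HM r k n i x. rewrite <- Hc by assumption.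
  repeat rewrite ?(m_K _ HM), ?(m_L _ HM). reflexivity.
Qed.

Lemma represents_differs_exists : exists c, represents_differs c.
Proof.
  destruct (CDef_not _ (CDef_differs (fun M z => cst CK (cst CK (cst CK (cst CK z))))
    (fun M z => cst CL (cst CK (cst CK (cst CK z)))) (fun M z => cst CL (cst CK (cst CK z)))
    (fun M z => cst CL (cst CK z)) (fun M z => cst CL z)
    ltac:(solve_CFun) ltac:(solve_CFun) ltac:(solve_CFun) ltac:(solve_CFun) ltac:(solve_CFun)))
    as [c Hc].
  exists c; intros M HM r k n i x. rewrite <- Hc by assumption.
  repeat rewrite ?(m_K _ HM), ?(m_L _ HM). reflexivity.
Qed.

Lemma good_represented : exists c, forall M : structure, is_model M -> forall r k n m : M,
  cst c (pair (pair (pair r k) n) m) = zero <-> good r k n m.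
Proof.
  destruct (CDef_good (fun M z => cst CK (cst CK (cst CK z)))
    (fun M z => cst CL (cst CK (cst CK z))) (fun M z => cst CL (cst CK z))
    (fun M z => cst CL z)
    ltac:(solve_CFun) ltac:(solve_CFun) ltac:(solve_CFun) ltac:(solve_CFun))
    as [c Hc].
  exists c; intros M HM r k n m. rewrite <- Hc by assumption.
  repeat rewrite ?(m_K _ HM), ?(m_L _ HM). reflexivity.
Qed.

(** The formula [homogeneous] begins with unbounded universal quantifiers and cannot be read off the
    models. The equation with this constant can, and it implies [homogeneous] derivably. *)
Lemma homog_represented : exists c, forall M : structure, is_model M -> forall a s l k : M,
  cst c (pair (pair (pair a s) l) k) = zero <-> homog a s l k.
Proof.
  destruct (CDef_homog (fun M z => cst CK (cst CK (cst CK z)))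
    (fun M z => cst CL (cst CK (cst CK z))) (fun M z => cst CL (cst CK z))
    (fun M z => cst CL z)
    ltac:(solve_CFun) ltac:(solve_CFun) ltac:(solve_CFun) ltac:(solve_CFun))
    as [c Hc].
  exists c; intros M HM a s l k. rewrite <- Hc by assumption.
  repeat rewrite ?(m_K _ HM), ?(m_L _ HM). reflexivity.
Qed.

Ltac split_antecedents H :=
  let H1 := fresh "H1" in pose proof (H _ (or_introl eq_refl)) as H1;
  try (let H2 := fresh "H2" in pose proof (H _ (or_intror (or_introl eq_refl))) as H2);
  try (let H3 := fresh "H3" in
       pose proof (H _ (or_intror (or_intror (or_introl eq_refl)))) as H3);
  clear H.

Lemma prv_above_zero c : represents_above c ->
  [] ⊢ ∀₁ incr_fun $0 ⇒ some_tuple (Succ #2) $0 (not_in c #4 #3 #2 Zero #0).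
Proof.
  intros Hc; apply prv_all1I, prv_impI.
  apply (by_models_from _ []); [members|members|classify|].
  intros M HM φ ψ Hψ _.
  destruct (above_zero_almost_full (ψ 0) (φ 2) (φ 1) (φ 0) (Hψ 0))
    as (s & Hs & x & Hx & Ha).
  exists s; split; [exact Hs|]; exists x; split; [exact Hx|].
  intros E; apply (Hc M HM) in E; exact (E Ha).
Qed.

(* IRT is applied to $1, the tuples with colour at least i, and $0, those with colour other than i. *)
Lemma prv_above_step cX cY : represents_above cX -> represents_differs cY ->
  let Γ := [∀₀ $0 @ #0 ≐ FConst cY @ J (J (J (J #4 #3) #2) #1) #0;
            ∀₀ $1 @ #0 ≐ FConst cX @ J (J (J (J #4 #3) #2) #1) #0;
            almost_full (Succ #2) (not_in cX #4 #3 #2 #1 #0)] in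
  Γ ⊢ almost_full (Succ #2) (not_in cX #4 #3 #2 (Succ #1) #0).
Proof.
  intros HX HY Γ.
  assert (HI : Γ ⊢ almost_full (Succ #2) (D $1) ⊓ almost_full (Succ #2) (D $0) ⇒
                   almost_full (Succ #2) (D $1 ⊓ D $0)).
  { refine (prv_instE1 _ _ $0 _ (prv_instE1 _ _ $1 _ (prv_IRT_succ Γ #2 _ eq_refl) eq_refl) _).
    reflexivity. }
  assert (Hα : Γ ⊢ almost_full (Succ #2) (D $1)).
  { refine (_ : _ ⊢ ∀₁ incr_fun $0 ⇒ some_tuple (Succ #3) $0 (D $2)).
    apply prv_all1I, prv_impI.
    apply (by_models_from _ [∀₀ $2 @ #0 ≐ FConst cX @ J (J (J (J #4 #3) #2) #1) #0;
      some_tuple (Succ #3) $0 (not_in cX #5 #4 #3 #2 #0)]);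
      [members; [hyp|]|members; classify|classify|].
    - apply (prv_impE _ _ (incr_fun $0)); [|hyp].
      refine (prv_instE1 _ (incr_fun $0 ⇒ some_tuple (Succ #3) $0 (not_in cX #5 #4 #3 #2 #0)) $0 _ _ eq_refl).
      hyp.
    - intros M HM φ ψ Hψ H. split_antecedents H.
      destruct H2 as (s & Hs & x & Hx & Ha).
      exists s; split; [exact Hs|]; exists x; split; [exact Hx|].
      intros E; apply Ha. rewrite <- E. symmetry; exact (H1 x). }
  assert (Hβ : Γ ⊢ almost_full (Succ #2) (D $0)).
  { refine (_ : _ ⊢ ∀₁ incr_fun $0 ⇒ some_tuple (Succ #3) $0 (D $1)).
    apply prv_all1I, prv_impI.
    apply (by_models_from _ [∀₀ $1 @ #0 ≐ FConst cY @ J (J (J (J #4 #3) #2) #1) #0;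
      incr_fun $0]); [members; hyp|members; classify|classify|].
    intros M HM φ ψ Hψ H. split_antecedents H.
    assert (Iζ : forall i j, lt i j -> lt (ψ 0 i) (ψ 0 j)) by exact H2.
    destruct (differs_almost_full (ψ 0) (φ 3) (φ 2) (φ 1) (φ 0) (Hψ 0) Iζ)
      as (s & Hs & x & Hx & Ha).
    exists s; split; [exact Hs|]; exists x; split; [exact Hx|].
    intros E; refine (proj1 (HY M HM (φ 3) (φ 2) (φ 1) (φ 0) x) _ Ha).
    rewrite <- E; symmetry; exact (H1 x). }
  pose proof (prv_impE _ _ _ _ HI (prv_andI _ _ _ _ Hα Hβ)) as HC. clear HI Hα Hβ.
  refine (_ : _ ⊢ ∀₁ incr_fun $0 ⇒
    some_tuple (Succ #3) $0 (not_in cX #5 #4 #3 (Succ #2) #0)).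
  apply prv_all1I, prv_impI.
  apply (by_models_from _ [∀₀ $2 @ #0 ≐ FConst cX @ J (J (J (J #4 #3) #2) #1) #0;
    ∀₀ $1 @ #0 ≐ FConst cY @ J (J (J (J #4 #3) #2) #1) #0;
    some_tuple (Succ #3) $0 (D $2 ⊓ D $1)]);
    [members; [hyp|hyp|]|members; classify|classify|].
  - apply (prv_impE _ _ (incr_fun $0)); [|hyp].
    refine (prv_instE1 _ (incr_fun $0 ⇒ some_tuple (Succ #3) $0 (D $3 ⊓ D $2)) $0 _ _ eq_refl).
    (* [HC] was derived before ζ became variable 0; a substitution shifts its derivation. *)
    apply (weakening _ (map lift1 Γ)); [|intros B HB; right; exact HB].
    refine (_ : _ ⊢ lift1 (almost_full (Succ #2) (D $1 ⊓ D $0))).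
    unfold lift1; exact (prv_subst _ _ _ theory_subst_closed HC _ _).
  - intros M HM φ ψ Hψ H. split_antecedents H.
    destruct H3 as (s & Hs & x & Hx & Ha & Hb).
    exists s; split; [exact Hs|]; exists x; split; [exact Hx|].
    intros E.
    refine (proj1 (HX M HM (φ 3) (φ 2) (φ 1) (succ (φ 0)) x) E _).
    apply above_succ; apply NNPP; intros K.
    + apply Ha. refine (eq_trans (H1 x) _). now apply HX.
    + apply Hb. refine (eq_trans (H2 x) _). now apply HY.
Qed.

(** The induction formula contains a function quantifier, so the induction is that of BIM and not
    that of the models. Under the quantifier, i, n, k, r are [#0], [#1], [#2], [#3]; in the second
    argument of [almost_full] they are shifted by one, [#0] being the tuple. *)
Lemma prv_above_all cX cY : represents_above cX -> represents_differs cY ->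
  [] ⊢ ∀₀ almost_full (Succ #2) (not_in cX #4 #3 #2 #1 #0).
Proof.
  intros HX HY; apply prv_ind; [exact (prv_above_zero cX HX)|].
  refine (_ : [almost_full (Succ #2) (not_in cX #4 #3 #2 #1 #0)] ⊢
              almost_full (Succ #2) (not_in cX #4 #3 #2 (Succ #1) #0)).
  eapply prv_ex1E.
  { exact (prv_instE0 _ _ (J (J (J #3 #2) #1) #0) _ (prv_section cX _) eq_refl). }
  eapply prv_ex1E.
  { exact (prv_instE0 _ _ (J (J (J #3 #2) #1) #0) _ (prv_section cY _) eq_refl). }
  exact (prv_above_step cX cY HX HY).
Qed.

Theorem theorem10p5 : provable (extend BIM all_IRT) PH.
Proof.
  destruct represents_above_exists as [cX HX], represents_differs_exists as [cY HY],
    good_represented as [cG HG], homog_represented as [cH HH].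
  refine (_ : [] ⊢ PH). apply prv_all0I, prv_all0I, prv_all0I.
  apply (prv_ex0E _ _ (FConst cG @ J (J (J #3 #2) #1) #0 ≐ Zero)).
  (* The identity serves as ζ. For i = r + 1 no colour remains, so the last entry of the tuple found
     is good. *)
  { apply (by_models_from _
      [some_tuple (Succ #2) (FConst CId) (not_in cX #4 #3 #2 (Succ #4) #0)]);
      [members|members; classify|classify|].
    - apply (prv_impE _ _ (incr_fun (FConst CId))); [|apply prv_incr_id].
      refine (prv_instE1 _ (incr_fun $0 ⇒ some_tuple (Succ #2) $0
        (not_in cX #4 #3 #2 (Succ #4) #0)) (FConst CId) _ _ _); [|reflexivity].
      exact (prv_instE0 _ _ (Succ #2) _ (prv_above_all cX cY HX HY) eq_refl).
    - intros M HM φ ψ _ H. specialize (H _ (in_eq _ _)).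
      destruct H as (s & _ & x & _ & Hx).
      exists (ent x (φ 1)). apply (HG M HM (φ 2) (φ 1) (φ 0)).
      apply above_all; apply NNPP; intros K; apply Hx. now apply HX. }
  refine (_ : _ ⊢ ∃₀ Zero ≺ #0 ⊓ ph_arrow #0 #2 #3 #4).
  apply (prv_ex0I _ _ _ #0), prv_andI.
  { apply (by_models_from _ [FConst cG @ J (J (J #3 #2) #1) #0 ≐ Zero] (Zero ≺ #0));
      [members; hyp|members; classify|classify|].
    intros M HM φ ψ _ H. specialize (H _ (in_eq _ _)).
    apply (HG M HM (φ 3) (φ 2) (φ 1) (φ 0)) in H. apply good_zero_lt in H.
    now apply (holds_flt φ ψ Zero #0). }
  refine (_ : _ ⊢ ph_arrow #0 #1 #2 #3). apply prv_all0I, prv_impI.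
  (* The models deliver l and s with homogeneity in equational form; [homogeneous] itself is derived
     from the equation at the end, for fixed u and v. *)
  apply (prv_ex0E _ _ (∃₀ Zero ≺ #1 ⊓ incr_seq_below #0 #3 #1 ⊓ #4 ≼ #1 ⊓
    tentry #0 Zero ≼ #1 ⊓ FConst cH @ J (J (J #2 #0) #1) #5 ≐ Zero)).
  { apply (by_models_from _ [colouring #0 #1 #3 #4; 
      FConst cG @ J (J (J #4 #3) #2) #1 ≐ Zero]); [members; hyp|members; classify|classify|].
    intros M HM φ ψ _ H. split_antecedents H.
    destruct H1 as (Q & _ & C). apply (HG M HM (φ 4) (φ 3) (φ 2) (φ 1)) in H2.
    destruct (NNPP (hit (φ 1) (φ 2) (φ 3) (φ 0))) as (l & s & K0 & K1 & K2 & K3 & K4).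
    (* Colours below r are also below r + 1, so without the required homogeneous set this colouring
       would be bad for a good m. *)
    - intros K; apply (H2 (φ 0)); split; [exact Q|split; [|exact K]].
      intros i Hi. assert (C' : lt (ent (φ 0) i) (φ 4)) by exact (C i Hi).
      exact (lt_trans _ _ _ C' (lt_S _)).
    - exists l, s; repeat (split; [assumption|]). now apply (HH M HM (φ 0) s l (φ 3)). }
  apply (prv_ex0E _ _ (Zero ≺ #1 ⊓ incr_seq_below #0 #3 #1 ⊓ #4 ≼ #1 ⊓
    tentry #0 Zero ≼ #1 ⊓ FConst cH @ J (J (J #2 #0) #1) #5 ≐ Zero)); [hyp|].
  apply (prv_ex0I _ _ _ #1), (prv_ex0I _ _ _ #0).
  refine (_ : _ ⊢ Zero ≺ #1 ⊓ incr_seq_below #0 #3 #1 ⊓ #4 ≼ #1 ⊓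
    tentry #0 Zero ≼ #1 ⊓ homogeneous #2 #0 #1 #5).
  apply prv_andI; [|apply prv_andI; [|apply prv_andI; [|apply prv_andI]]].
  - eapply prv_andE1; hyp.
  - eapply prv_andE1, prv_andE2; hyp.
  - eapply prv_andE1, prv_andE2, prv_andE2; hyp.
  - eapply prv_andE1, prv_andE2, prv_andE2, prv_andE2; hyp.
  - apply prv_all0I, prv_all0I, prv_impI, prv_impI.
    apply (by_models_from _ [incr_seq_below #1 #3 #7; incr_seq_below #0 #3 #7;
      FConst cH @ J (J (J #4 #2) #3) #7 ≐ Zero]);
      [members; [hyp|hyp|]|members; classify|classify|].
    + refine (prv_andE2 _ _ (tentry #2 Zero ≼ #3) _ _).
      eapply prv_andE2, prv_andE2, prv_andE2; hyp.
    + intros M HM φ ψ _ H. split_antecedents H.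
      apply (HH M HM (φ 4) (φ 2) (φ 3) (φ 7)) in H3. exact (H3 (φ 1) (φ 0) H1 H2).
Qed.
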